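(* Let $J\in\{1,2\}$ and suppose $\widetilde{\bm f}_h^{n+1}=\bm 0$. Then the scheme (PG) described in the context satisfies, for every $n\ge0$ if $J=1$ and every $n\ge1$ if $J=2$, the modified discrete energy law $$\mathscr{E}^{n+1}-\mathscr{E}^n=-\mathscr{Q}^{n+1}-\frac{4\tau}{\mathrm{Re}}\|(\widetilde{\eta}_h^{n+1})^{1/2}\mathbb{D}(\bm{u}_h^{n+1})\|^2-\frac{2\tau}{T}|Q^{n+1}|^2-\frac{2\tau}{\mathrm{Pe}\,\mathrm{We}\,\mathrm{Cn}}\|\nabla\mu_h^{n+1}\|^2,$$ where, for $J=1$, $$\mathscr{E}^n=\|(\widetilde{\sigma}\bm{u})_h^n\|^2+\frac{\mathrm{Cn}}{\mathrm{We}}\|\nabla\phi_h^n\|^2+\frac{s}{\mathrm{We}\,\mathrm{Cn}}\|\phi_h^n\|^2+\frac{2}{\mathrm{We}\,\mathrm{Cn}}|R^n|^2+|Q^n|^2,$$ $$\mathscr{Q}^n=\|\mathscr{D}(\widetilde{\sigma}\bm{u})_h^n\|^2+\frac{s}{\mathrm{We}\,\mathrm{Cn}}\|\mathscr{D}\phi_h^n\|^2+\frac{\mathrm{Cn}}{\mathrm{We}}\|\nabla\mathscr{D}\phi_h^n\|^2+\frac{2}{\mathrm{We}\,\mathrm{Cn}}|\mathscr{D}R^n|^2+|\mathscr{D}Q^n|^2,$$ and, for $J=2$, $$\begin{aligned}\mathscr{E}^n=&\tfrac12\|(\widetilde{\sigma}\bm{u})_h^n\|^2+\tfrac12\|\widetilde{(\widetilde{\sigma}\bm{u})}_h^{n+1}\|^2+\tfrac{\mathrm{Cn}}{2\mathrm{We}}\|\nabla\phi_h^n\|^2+\tfrac{\mathrm{Cn}}{2\mathrm{We}}\|\nabla\widetilde{\phi}_h^{n+1}\|^2+\tfrac{s}{2\mathrm{We}\,\mathrm{Cn}}\|\phi_h^n\|^2+\tfrac{s}{2\mathrm{We}\,\mathrm{Cn}}\|\widetilde{\phi}_h^{n+1}\|^2\\&+\tfrac{1}{\mathrm{We}\,\mathrm{Cn}}|R^n|^2+\tfrac{1}{\mathrm{We}\,\mathrm{Cn}}|\widetilde{R}^{n+1}|^2+\tfrac12|Q^n|^2+\tfrac12|\widetilde{Q}^{n+1}|^2,\end{aligned}$$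 $$\mathscr{Q}^n=\tfrac12\|\mathscr{D}^2(\widetilde{\sigma}\bm{u})_h^n\|^2+\tfrac{\mathrm{Cn}}{2\mathrm{We}}\|\nabla\mathscr{D}^2\phi_h^n\|^2+\tfrac{s}{2\mathrm{We}\,\mathrm{Cn}}\|\mathscr{D}^2\phi_h^n\|^2+\tfrac{1}{\mathrm{We}\,\mathrm{Cn}}|\mathscr{D}^2R^n|^2+\tfrac12|\mathscr{D}^2Q^n|^2.$$
   Context: Domain and spaces. $\Omega\subset\mathbb{R}^d$ ($d=2,3$) is a bounded connected Lipschitz domain; $(\cdot,\cdot)$, $\|\cdot\|$ are the $L^2(\Omega)$ inner product and norm, $\|\cdot\|_1$ the $H^1(\Omega)$ norm. On a quasi-uniform triangulation of mesh size $h$ let $V_h\subset H^1(\Omega)$, $\bm X_h\subset H^1_0(\Omega)^d$, $N_h\subset H^1(\Omega)$ be conforming (continuous piecewise polynomial, finite dimensional) finite element spaces, and $M_h=N_h\cap L^2_0(\Omega)$ ($L^2_0$: zero mean). The inf-sup (LBB) condition holds: there is $C>0$ independent of $h$ with $\inf_{0\ne q\in M_h}\sup_{0\ne\bm v\in\bm X_h}\frac{(\nabla\cdot\bm v,q)}{\|\bm v\|_1\|q\|}\ge C$. Parameters. $\mathrm{Cn},\mathrm{Pe},\mathrm{Re},\mathrm{We},\mathrm{Fr}>0$ (dimensionless numbers), $\rho_1,\rho_2,\eta_1,\eta_2,\rho_r,\eta_r>0$, $s,S>0$, final time $T>0$, uniform time step $\tau$ ($T/\tau$ a positive integer), $t^n=n\tau$.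 $F(\phi)=\frac14(\phi^2-1)^2$, $G(\phi)=F(\phi)-\frac s2\phi^2$; $S$ is such that $\int_\Omega G(\phi)\,\mathrm{d}\bm x+S>0$ for all relevant $\phi$. The mobility is constant, normalized to $m=1$. Time notation, for a generic quantity $\chi$: $\delta_\tau\chi^{n+1}=(\gamma_0\chi^{n+1}-\hat\chi)/\tau$, where for $J=1$: $\gamma_0=1$, $\hat\chi=\chi^n$, and the extrapolation is $\widetilde\chi^{n+1}=\chi^n$; for $J=2$: $\gamma_0=\frac32$, $\hat\chi=2\chi^n-\frac12\chi^{n-1}$, $\widetilde\chi^{n+1}=2\chi^n-\chi^{n-1}$. Also $\mathscr D\chi^{n+1}=\chi^{n+1}-\chi^n$, $\mathscr D^2\chi^{n+1}=\chi^{n+1}-2\chi^n+\chi^{n-1}$. Coefficients. $\widetilde\phi_h^{n+1},\widetilde\mu_h^{n+1},\widetilde{\bm u}_h^{n+1}$, and in the energy $\widetilde R^{n+1},\widetilde Q^{n+1}$ and $\widetilde{(\widetilde\sigma\bm u)}_h^{n+1}=2(\widetilde\sigma\bm u)_h^n-(\widetilde\sigma\bm u)_h^{n-1}$ (for $J=2$), are extrapolations. With the cut-off $\phi^{\mathscr C}=\phi$ if $|\phi|\le1$ and $\phi^{\mathscr C}=\mathrm{sign}(\phi)$ otherwise, set $\rho(\phi)=\frac{\rho_1-\rho_2}{2\rho_r}\phi^{\mathscr C}+\frac{\rho_1+\rho_2}{2\rho_r}$, $\eta(\phi)=\frac{\eta_1-\eta_2}{2\eta_r}\phi^{\mathscr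 C}+\frac{\eta_1+\eta_2}{2\eta_r}$, $\sigma=\sqrt\rho$, $U(\phi)=\sqrt{\int_\Omega G(\phi)\,\mathrm{d}\bm x+S}$, and $\widetilde\rho_h^{n+1}=\rho(\widetilde\phi_h^{n+1})$, $\widetilde\eta_h^{n+1}=\eta(\widetilde\phi_h^{n+1})$, $\widetilde\sigma_h^{n+1}=\sigma(\widetilde\phi_h^{n+1})$, $\widetilde U^{n+1}=U(\widetilde\phi_h^{n+1})$, $\widetilde{\bm J}_h^{n+1}=-\frac{\rho_1-\rho_2}{2\rho_r\mathrm{Pe}}\nabla\widetilde\mu_h^{n+1}$; $(\widetilde\sigma\bm u)_h^n=\widetilde\sigma_h^n\bm u_h^n$ with $\widetilde\sigma_h^0=\sigma(\phi_h^0)$. $\mathbb D(\bm u)=\frac12(\nabla\bm u+\nabla\bm u^T)$; $\widetilde{\bm f}_h^{n+1}\in L^2(\Omega)^d$ is the gravity force evaluated at $\widetilde\rho_h^{n+1}$. Further $\xi_1^{n+1}=R^{n+1}/\widetilde U^{n+1}$, $\xi_2^{n+1}=e^{t^{n+1}/T}Q^{n+1}$. Write $\widetilde{\bm w}=\widetilde\rho_h^{n+1}\widetilde{\bm u}_h^{n+1}+\widetilde{\bm J}_h^{n+1}$ and $\mathcal B^{n+1}(\bm v)=(\widetilde{\bm w}\cdot\nabla\widetilde{\bm u}_h^{n+1},\bm v)-(\widetilde{\bm w}\cdot\nabla\bm v,\widetilde{\bm u}_h^{n+1})$, where $(\bm w\cdot\nabla\bm u)_i=\sum_j w_j\partial_ju_i$.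 Scheme (PG): given the previous levels, $(\phi_h^{n+1},\mu_h^{n+1})\in V_h\times V_h$, $(\bm u_h^{n+1},P_h^{n+1})\in\bm X_h\times M_h$, $R^{n+1},Q^{n+1}\in\mathbb R$ satisfy, for all $(\psi_h,\omega_h)\in V_h\times V_h$, $(\bm v_h,q_h)\in\bm X_h\times M_h$: (i) $(\delta_\tau\phi_h^{n+1},\omega_h)=\xi_1^{n+1}(\widetilde\phi_h^{n+1}\widetilde{\bm u}_h^{n+1},\nabla\omega_h)-\frac1{\mathrm{Pe}}(\nabla\mu_h^{n+1},\nabla\omega_h)$; (ii) $(\mu_h^{n+1},\psi_h)=\mathrm{Cn}^2(\nabla\phi_h^{n+1},\nabla\psi_h)+s(\phi_h^{n+1},\psi_h)+\xi_1^{n+1}(G'(\widetilde\phi_h^{n+1}),\psi_h)$; (iii) $\delta_\tau R^{n+1}=\frac1{2\widetilde U^{n+1}}\big((G'(\widetilde\phi_h^{n+1}),\delta_\tau\phi_h^{n+1})-(\widetilde\phi_h^{n+1}\widetilde{\bm u}_h^{n+1},\nabla\mu_h^{n+1})+(\widetilde\phi_h^{n+1}\nabla\widetilde\mu_h^{n+1},\bm u_h^{n+1})\big)$; (iv) $(\widetilde\sigma_h^{n+1}\delta_\tau(\widetilde\sigma\bm u)_h^{n+1},\bm v_h)+\frac2{\mathrm{Re}}(\widetilde\eta_h^{n+1}\mathbb D(\bm u_h^{n+1}),\mathbb D(\bm v_h))-(P_h^{n+1},\nabla\cdot\bm v_h)+(\nabla\cdot\bm u_h^{n+1},q_h)=-\frac{\xi_2^{n+1}}2\mathcal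 B^{n+1}(\bm v_h)-\frac{\xi_1^{n+1}}{\mathrm{We}\,\mathrm{Cn}}(\widetilde\phi_h^{n+1}\nabla\widetilde\mu_h^{n+1},\bm v_h)+\frac1{\mathrm{Fr}}(\widetilde{\bm f}_h^{n+1},\bm v_h)$; (v) $\delta_\tau Q^{n+1}=-\frac{Q^{n+1}}T+\frac12e^{t^{n+1}/T}\mathcal B^{n+1}(\bm u_h^{n+1})$. *)

(* Defs.v *)
From HB Require Import structures.
From mathcomp Require Import all_boot all_order all_algebra.
From mathcomp Require Import all_classical all_reals all_analysis.
From mathcomp Require mpoly.
Set Implicit Arguments.
Unset Strict Implicit.
Unset Printing Implicit Defensive.
Import Order.TTheory GRing.Theory Num.Theory.
Import numFieldNormedType.Exports.
Local Open Scope classical_set_scope.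
Local Open Scope ring_scope.

Definition measure_rV_display : measure_display.
Proof. exact: default_measure_display. Qed.

(* 'rV[R]_n carries the sigma-algebra generated by the coordinates, i.e. the
   Borel sets, as n.-tuple R does in the library. *)
Section measurable_rV.
Context {R : realType}.
Variable n : nat.

Let coor (i : 'I_n) (x : 'rV[R]_n) : R := x 0 i.

Let rV_set0 : g_sigma_preimage coor set0.
Proof. exact: sigma_algebra0. Qed.

Let rV_setC A : g_sigma_preimage coor A -> g_sigma_preimage coor (~` A).
Proof. exact: sigma_algebraC. Qed.

Let rV_bigcup (F : _^nat) : (forall i, g_sigma_preimage coor (F i)) ->
  g_sigma_preimage coor (\bigcup_i (F i)).
Proof. exact: sigma_algebra_bigcup. Qed.

HB.instance Definition _ := @isMeasurable.Build measure_rV_display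
  'rV[R]_n (g_sigma_preimage coor) rV_set0 rV_setC rV_bigcup.

Lemma measurable_coor (i : 'I_n) :
  measurable_fun [set: 'rV[R]_n] (fun x : 'rV[R]_n => x 0 i).
Proof.
move=> _ Y mY; rewrite setTI; apply: sub_sigma_algebra => /=.
rewrite -bigcup_seq/=; exists i => /=; first by rewrite mem_index_enum.
by exists Y => //; rewrite setTI.
Qed.

Lemma measurable_fun_coorP d (T : measurableType d) (f : T -> 'rV[R]_n) :
  (forall i, measurable_fun [set: T] (fun t => f t 0 i)) ->
  measurable_fun [set: T] f.
Proof.
move=> mf _ B mB; rewrite setTI.
have : (preimage_set_system [set: T] f (g_sigma_preimage coor)) `<=` measurable.
  rewrite -g_sigma_preimage_comp; apply: smallest_sub => //.
    exact: sigma_algebra_measurable.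
  rewrite -bigcup_seq; apply: bigcup_sub => i _ A [C mC <-].
  exact: mf.
by apply; exists B => //; rewrite setTI.
Qed.

End measurable_rV.

Section lebesgue_rV.
Context {R : realType}.

Definition rV_cons n (p : measurableTypeR R * 'rV[R]_n) : 'rV[R]_n.+1 :=
  row_mx (p.1 : R)%:M p.2.

Lemma rV_cons0 n p : @rV_cons n p 0 ord0 = p.1.
Proof.
rewrite /rV_cons (_ : ord0 = lshift n (ord0 : 'I_1)); last exact/val_inj.
by rewrite (@row_mxEl _ 1 1 n) mxE eqxx mulr1n.
Qed.

Lemma rV_consS n p i : @rV_cons n p 0 (lift ord0 i) = p.2 0 i.
Proof.
rewrite /rV_cons (_ : lift ord0 i = rshift 1 i); last exact/val_inj.
by rewrite (@row_mxEr _ 1 1 n).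
Qed.

Lemma measurable_rV_cons n : measurable_fun setT (@rV_cons n).
Proof.
apply: measurable_fun_coorP => i.
case: (unliftP ord0 i) => [j|] ->.
- under eq_fun do rewrite rV_consS.
  exact: (measurableT_comp (measurable_coor j) measurable_snd).
- under eq_fun do rewrite rV_cons0.
  exact: measurable_fst.
Qed.

Definition rV_uncons n (x : 'rV[R]_n.+1) : measurableTypeR R * 'rV[R]_n :=
  (x 0 ord0, \row_i x 0 (lift ord0 i)).

Lemma measurable_rV_uncons n : measurable_fun setT (@rV_uncons n).
Proof.
apply: measurable_fun_pair => /=; first exact: (measurable_coor ord0).
apply: measurable_fun_coorP => i.
under eq_fun do rewrite mxE.
exact: measurable_coor.
Qed.

Lemma rV_consK n : cancel (@rV_cons n) (@rV_uncons n).
Proof.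
move=> p; rewrite /rV_uncons rV_cons0 [RHS]surjective_pairing; congr pair.
by apply/rowP => i; rewrite mxE rV_consS.
Qed.

HB.instance Definition _ n :=
  isMeasurableFun.Build _ _ _ _ (@rV_cons n) (@measurable_rV_cons n).

Section lebesgue_rV_step.
Context n (m : {sigma_finite_measure set 'rV[R]_n -> \bar R}).

Definition lebesgue_rV_step : set 'rV[R]_n.+1 -> \bar R :=
  pushforward (@lebesgue_measure R \x m)%E (@rV_cons n).

Let step0 : lebesgue_rV_step set0 = 0%E.
Proof. exact: measure0. Qed.

Let step_ge0 A : (0 <= lebesgue_rV_step A)%E.
Proof. exact: measure_ge0. Qed.

Let step_sigma_additive : semi_sigma_additive lebesgue_rV_step.
Proof. exact: measure_semi_sigma_additive. Qed.

HB.instance Definition _ := isMeasure.Build _ _ _ lebesgue_rV_step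
  step0 step_ge0 step_sigma_additive.

Let step_sigma_finite : sigma_finite setT lebesgue_rV_step.
Proof.
have /sigma_finiteP[F [TF ndF Foo]] := sigma_finiteT (@lebesgue_measure R).
have /sigma_finiteP[G [TG ndG Goo]] := sigma_finiteT m.
exists (fun k => @rV_uncons n @^-1` (F k `*` G k)).
  rewrite -preimage_bigcup -[LHS](preimage_setT (@rV_uncons n)); congr preimage.
  rewrite -setXTT TF TG predeqE => -[x y]; split.
    move=> [/= [i _ Fnx] [k _ Gky]]; exists (maxn i k) => //; split.
    - by move: x Fnx; exact/subsetPset/ndF/leq_maxl.
    - by move: y Gky; exact/subsetPset/ndG/leq_maxr.
  by move=> [i _ []/= ? ?]; split; exists i.
move=> k; have [mF Fk] := Foo k; have [mG Gk] := Goo k; split.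
  rewrite -[X in measurable X]setTI; apply: measurable_rV_uncons => //.
  exact: measurableX.
rewrite /lebesgue_rV_step /pushforward -comp_preimage.
have -> : @rV_uncons n \o @rV_cons n = id.
  by apply/funext => p /=; rewrite rV_consK.
by rewrite preimage_id product_measure1E// lte_mul_pinfty// ge0_fin_numE.
Qed.

HB.instance Definition _ := Measure_isSigmaFinite.Build _ _ _
  lebesgue_rV_step step_sigma_finite.

End lebesgue_rV_step.

(* Lebesgue measure on R^n: the n-fold product of the one on R, transported
   from R * 'rV_n to 'rV_n.+1; lebesgue_rV_box gives its values on boxes. *)
Fixpoint lebesgue_rV n : {sigma_finite_measure set 'rV[R]_n -> \bar R} :=
  match n with
  | 0 => [the {sigma_finite_measure set 'rV[R]_0 -> \bar R} of
          @dirac _ 'rV[R]_0 0 R]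
  | n'.+1 => [the {sigma_finite_measure set 'rV[R]_n'.+1 -> \bar R} of
              lebesgue_rV_step (lebesgue_rV n')]
  end.

Lemma lebesgue_rV_box n (A : 'I_n -> set (measurableTypeR R)) :
  (forall i, measurable (A i)) ->
  lebesgue_rV n [set x : 'rV[R]_n | forall i, A i (x 0 i)] =
  (\prod_(i < n) lebesgue_measure (A i))%E.
Proof.
elim: n A => [|n IH] A mA /=.
  rewrite big_ord0 (_ : [set _ | _] = setT) ?diracT//.
  by apply/seteqP; split=> // x _ [].
rewrite /lebesgue_rV_step /pushforward.
have -> : @rV_cons n @^-1` [set x : 'rV[R]_n.+1 | forall i, A i (x 0 i)] =
    A ord0 `*` [set x : 'rV[R]_n | forall i : 'I_n, A (lift ord0 i) (x 0 i)].
  apply/seteqP; split => [p /= Ap|p /= [p0 pS] i].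
    split; first by have := Ap ord0; rewrite rV_cons0.
    by move=> i; have := Ap (lift ord0 i); rewrite rV_consS.
  by case: (unliftP ord0 i) => [j|] ->; rewrite ?rV_consS ?rV_cons0.
have mAS : measurable [set x : 'rV[R]_n | forall i : 'I_n, A (lift ord0 i) (x 0 i)].
  have -> : [set x : 'rV[R]_n | forall i : 'I_n, A (lift ord0 i) (x 0 i)] =
      \big[setI/setT]_(i < n) ((fun x : 'rV[R]_n => x 0 i) @^-1` A (lift ord0 i)).
    rewrite -bigcap_seq; apply/seteqP; split => [x Ax i _|x Ax i] /=.
      exact: Ax.
    by have := Ax i; apply; rewrite /= mem_index_enum.
  apply: bigsetI_measurable => i _.
  by have := @measurable_coor R n i measurableT _ (mA (lift ord0 i)); rewrite setTI.
rewrite product_measure1E //= big_ord_recl; congr (_ * _)%E.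
by rewrite (IH (fun i => A (lift ord0 i))).
Qed.

End lebesgue_rV.

Section sobolev.
Context {R : realType} {d : nat}.
Implicit Types (Om : set 'rV[R]_d) (f g v : 'rV[R]_d -> R)
  (u w : 'rV[R]_d -> 'rV[R]_d).

Definition partial (i : 'I_d) f : 'rV[R]_d -> R :=
  fun x => 'D_(delta_mx 0 i) f x.

Definition smooth f :=
  forall s : seq 'I_d, let g := foldr partial f s in
    continuous g /\ forall i x, derivable g x (delta_mx 0 i).

(* C_c^oo(Om) *)
Definition test_function Om f :=
  smooth f /\
  exists K, [/\ compact K, K `<=` Om & forall x, ~ K x -> f x = 0].

Definition vint Om f : R := \int[lebesgue_rV d]_(x in Om) f x.

Definition L2 Om f :=
  measurable_fun Om f /\
  (lebesgue_rV d).-integrable Om (fun x => ((f x) ^+ 2)%:E).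

Definition L2vec Om u := forall i, L2 Om (fun x => u x 0 i).

Definition ae_zero (T : zmodType) Om (f : 'rV[R]_d -> T) :=
  {ae lebesgue_rV d, forall x, Om x -> f x = 0}.

Definition dotL2 Om f g : R := vint Om (fun x => f x * g x).

Definition normL2 Om f : R := Num.sqrt (dotL2 Om f f).

(* L^2 product of fields with values in 'rV_d (euclidean product) or 'M_d
   (Frobenius product) *)
Definition mxdotL2 p q Om (A B : 'rV[R]_d -> 'M[R]_(p, q)) : R :=
  vint Om (fun x => \sum_i \sum_j A x i j * B x i j).

Definition mxnormL2 p q Om (A : 'rV[R]_d -> 'M[R]_(p, q)) : R :=
  Num.sqrt (mxdotL2 Om A A).

Definition weak_grad Om v (g : 'rV[R]_d -> 'rV[R]_d) :=
  L2vec Om g /\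
  forall i psi, test_function Om psi ->
    dotL2 Om v (partial i psi) = - dotL2 Om (fun x => g x 0 i) psi.

Definition H1 Om v := L2 Om v /\ exists g : 'rV[R]_d -> 'rV[R]_d, weak_grad Om v g.

(* a representative of the weak gradient, which is unique almost everywhere *)
Definition grad Om v : 'rV[R]_d -> 'rV[R]_d :=
  xget (fun=> 0) [set g | weak_grad Om v g].

Definition normH1 Om v : R :=
  Num.sqrt (normL2 Om v ^+ 2 + mxnormL2 Om (grad Om v) ^+ 2).

(* H^1_0, the closure of C_c^oo(Om) in H^1(Om) *)
Definition H10 Om v :=
  H1 Om v /\
  forall e, 0 < e -> exists2 psi, test_function Om psi & normH1 Om (v - psi) < e.

Definition H10vec Om u := forall i, H10 Om (fun x => u x 0 i).

(* (jac u)_ij = d_j u_i *)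
Definition jac Om u : 'rV[R]_d -> 'M[R]_d :=
  fun x => \matrix_(i, j) grad Om (fun y => u y 0 i) x 0 j.

Definition div Om u : 'rV[R]_d -> R := fun x => \tr (jac Om u x).

Definition symgrad Om u : 'rV[R]_d -> 'M[R]_d :=
  fun x => 2^-1 *: (jac Om u x + (jac Om u x)^T).

(* w . grad u *)
Definition convect Om w u : 'rV[R]_d -> 'rV[R]_d :=
  fun x => \row_i \sum_j w x 0 j * jac Om u x i j.

Definition normH1vec Om u : R :=
  Num.sqrt (mxnormL2 Om u ^+ 2 + mxnormL2 Om (jac Om u) ^+ 2).

End sobolev.

Section domain_and_mesh.
Context {R : realType} {d : nat}.
Implicit Types (Om : set 'rV[R]_d).

(* Near each boundary point and in suitable orthonormal coordinates z, the
   domain is the strict epigraph z_i > gam (other coordinates of z). *)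
Definition lipschitz_domain Om :=
  [/\ open Om, connected Om, bounded_set Om, Om !=set0 &
    forall x, (closure Om `\` Om) x ->
      exists r (A : 'M[R]_d) (i : 'I_d) (gam : 'rV[R]_d.-1 -> R) (k : R),
        [/\ 0 < r, A *m A^T = 1%:M, k.-lipschitz gam &
          forall y, ball x r y ->
            let z := (y - x) *m A in Om y <-> gam (col' i z) < z 0 i]].

Definition enorm (x : 'rV[R]_d) : R := Num.sqrt (\sum_i x 0 i ^+ 2).

Definition diam (A : set 'rV[R]_d) : R :=
  sup [set e | exists x y, [/\ A x, A y & e = enorm (x - y)]].

(* A simplex is the matrix whose d + 1 rows are its vertices. *)
Definition barycentric (l : 'rV[R]_d.+1) :=
  (forall i, 0 <= l 0 i) /\ \sum_i l 0 i = 1.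

Definition hull (K : 'M[R]_(d.+1, d)) : set 'rV[R]_d :=
  [set l *m K | l in barycentric].

(* the convex hull of the vertices common to K and K' *)
Definition common_face (K K' : 'M[R]_(d.+1, d)) : set 'rV[R]_d :=
  [set l *m K | l in [set l | barycentric l /\
     forall i, l 0 i != 0 -> exists j, row i K = row j K']].

Definition nondegenerate (K : 'M[R]_(d.+1, d)) :=
  row_free (row_mx K (const_mx 1 : 'cV[R]_d.+1)).

Definition triangulation Om (T : set 'M[R]_(d.+1, d)) :=
  [/\ finite_set T, (forall K, T K -> nondegenerate K),
    \bigcup_(K in T) hull K = closure Om &
    forall K K', T K -> T K' -> hull K `&` hull K' = common_face K K'].

Definition mesh_size (T : set 'M[R]_(d.+1, d)) : R :=
  sup [set diam (hull K) | K in T].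

Definition quasi_uniform (Hs : set R) (Th : R -> set 'M[R]_(d.+1, d)) :=
  exists2 c : R, 0 < c & forall h K, Hs h -> Th h K ->
    exists x, [set y | enorm (y - x) < c * mesh_size (Th h)] `<=` hull K.

Definition continuous_piecewise_poly Om (T : set 'M[R]_(d.+1, d))
    (v : 'rV[R]_d -> R) :=
  {within closure Om, continuous v} /\
  forall K, T K -> exists p : mpoly.mpoly d R,
    forall x, hull K x -> v x = mpoly.meval (fun i => x 0 i) p.

Definition finite_dim_subspace (W : lmodType R) (V : set W) :=
  exists (m : nat) (b : 'I_m -> W),
    V = [set \sum_i c i *: b i | c in [set: 'I_m -> R]].

Definition zero_mean Om (V : set ('rV[R]_d -> R)) : set ('rV[R]_d -> R) :=
  [set q | V q /\ vint Om q = 0].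

Definition inf_sup Om (M : set ('rV[R]_d -> R))
    (X : set ('rV[R]_d -> 'rV[R]_d)) : \bar R :=
  ereal_inf [set r | exists q, [/\ M q, ~ ae_zero Om q &
    r = ereal_sup [set t | exists v, [/\ X v, ~ ae_zero Om v &
      t = (dotL2 Om (div Om v) q / (normH1vec Om v * normL2 Om q))%:E]]]].

(* Families are indexed by the mesh sizes h in Hs; quasi-uniformity and the
   inf-sup condition are uniform in h. *)
Record finite_element_setting Om (Hs : set R)
    (Th : R -> set 'M[R]_(d.+1, d)) (Vh : R -> set ('rV[R]_d -> R))
    (Xh : R -> set ('rV[R]_d -> 'rV[R]_d)) (Nh : R -> set ('rV[R]_d -> R))
    : Prop := {
  fe_domain : lipschitz_domain Om;
  fe_mesh : forall h, Hs h ->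
    [/\ 0 < h, triangulation Om (Th h) & mesh_size (Th h) = h];
  fe_quasi_uniform : quasi_uniform Hs Th;
  fe_Vh : forall h, Hs h -> finite_dim_subspace (Vh h) /\
    forall v, Vh h v -> continuous_piecewise_poly Om (Th h) v /\ H1 Om v;
  fe_Xh : forall h, Hs h -> finite_dim_subspace (Xh h) /\
    forall v, Xh h v -> H10vec Om v /\
      forall i, continuous_piecewise_poly Om (Th h) (fun x => v x 0 i);
  fe_Nh : forall h, Hs h -> finite_dim_subspace (Nh h) /\
    forall q, Nh h q -> continuous_piecewise_poly Om (Th h) q /\ H1 Om q;
  fe_inf_sup : exists2 C : R, 0 < C & forall h, Hs h ->
    (C%:E <= inf_sup Om (zero_mean Om (Nh h)) (Xh h))%E
}.

End domain_and_mesh.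

Section time_notation.
Context {R : realType} {W : lmodType R} (J : nat).
Implicit Types chi : nat -> W.

(* [hatted chi n], [extrap chi n] and [ddt tau chi n] are the quantities
   attached to level n + 1. *)
Definition gamma0 : R := if J == 1%N then 1 else 3 / 2.

Definition hatted chi n : W :=
  if J == 1%N then chi n else 2 *: chi n - 2^-1 *: chi n.-1.

Definition extrap chi n : W :=
  if J == 1%N then chi n else 2 *: chi n - chi n.-1.

Definition ddt (tau : R) chi n : W :=
  tau^-1 *: (gamma0 *: chi n.+1 - hatted chi n).

Definition diff1 chi n : W := chi n - chi n.-1.

Definition diff2 chi n : W := chi n - 2 *: chi n.-1 + chi n.-2.

End time_notation.

(* the mobility is 1; [stab] and [shift] are the constants s and S in
   G = F - s/2 phi^2 and U = sqrt (int G + S) *)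
Record params (R : realType) := Params {
  Cahn : R; Peclet : R; Reynolds : R; Weber : R; Froude : R;
  rho1 : R; rho2 : R; rhor : R; eta1 : R; eta2 : R; etar : R;
  stab : R; shift : R;
  params_gt0 : [/\
    [/\ 0 < Cahn, 0 < Peclet, 0 < Reynolds, 0 < Weber & 0 < Froude],
    [/\ 0 < rho1, 0 < rho2 & 0 < rhor],
    [/\ 0 < eta1, 0 < eta2 & 0 < etar] & 0 < stab /\ 0 < shift]
}.

Section coefficients.
Context {R : realType} {d : nat} (par : params R).

Definition cutoff (a : R) : R := if `|a| <= 1 then a else Num.sg a.

Definition rho (a : R) : R :=
  (rho1 par - rho2 par) / (2 * rhor par) * cutoff a
  + (rho1 par + rho2 par) / (2 * rhor par).

Definition eta (a : R) : R :=
  (eta1 par - eta2 par) / (2 * etar par) * cutoff a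
  + (eta1 par + eta2 par) / (2 * etar par).

Definition sigma (a : R) : R := Num.sqrt (rho a).

Definition potF (a : R) : R := 4^-1 * (a ^+ 2 - 1) ^+ 2.

Definition potG (a : R) : R := potF a - stab par / 2 * a ^+ 2.

Definition shiftedG (Om : set 'rV[R]_d) (f : 'rV[R]_d -> R) : R :=
  vint Om (fun x => potG (f x)) + shift par.

Definition auxU (Om : set 'rV[R]_d) (f : 'rV[R]_d -> R) : R :=
  Num.sqrt (shiftedG Om f).

End coefficients.

(* [phit n] is the extrapolation of phi at level n. It is prescribed by the
   scheme at the levels n >= J only; for J = 2, [phit 1] belongs to the
   starting data. *)
Record trajectory (R : realType) (d : nat) := Trajectory {
  phi : nat -> 'rV[R]_d -> R;
  mu : nat -> 'rV[R]_d -> R;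
  vel : nat -> 'rV[R]_d -> 'rV[R]_d;
  pres : nat -> 'rV[R]_d -> R;
  auxR : nat -> R^o;
  auxQ : nat -> R^o;
  phit : nat -> 'rV[R]_d -> R
}.

Section scheme.
Context {R : realType} {d : nat} (par : params R) (Om : set 'rV[R]_d)
  (J : nat) (T tau : R) (force : ('rV[R]_d -> R) -> 'rV[R]_d -> 'rV[R]_d)
  (X : trajectory R d).

Definition rhot n : 'rV[R]_d -> R := fun x => rho par (phit X n x).

Definition etat n : 'rV[R]_d -> R := fun x => eta par (phit X n x).

Definition sigmat n : 'rV[R]_d -> R :=
  fun x => sigma par (if n is 0 then phi X 0 x else phit X n x).

Definition sigmau n : 'rV[R]_d -> 'rV[R]_d :=
  fun x => sigmat n x *: vel X n x.

Definition forcet n : 'rV[R]_d -> 'rV[R]_d := force (rhot n).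

Definition mut n : 'rV[R]_d -> R := extrap J (mu X) n.

Definition velt n : 'rV[R]_d -> 'rV[R]_d := extrap J (vel X) n.

Definition expt n : R := expR (n%:R * tau / T).

Definition xi1 n : R := auxR X n / auxU par Om (phit X n).

Definition xi2 n : R := expt n * auxQ X n.

Definition fluxJ n : 'rV[R]_d -> 'rV[R]_d :=
  fun x => - ((rho1 par - rho2 par) / (2 * rhor par * Peclet par))
             *: grad Om (mut n) x.

Definition transport n : 'rV[R]_d -> 'rV[R]_d :=
  fun x => rhot n.+1 x *: velt n x + fluxJ n x.

Definition formB n (v : 'rV[R]_d -> 'rV[R]_d) : R :=
  mxdotL2 Om (convect Om (transport n) (velt n)) v
  - mxdotL2 Om (convect Om (transport n) v) (velt n).

Definition phi_velt n : 'rV[R]_d -> 'rV[R]_d :=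
  fun x => phit X n.+1 x *: velt n x.

Definition phi_grad_mut n : 'rV[R]_d -> 'rV[R]_d :=
  fun x => phit X n.+1 x *: grad Om (mut n) x.

Definition dpotG n : 'rV[R]_d -> R := fun x => derive1 (potG par) (phit X n x).

(* the equations (PG) for the unknowns of level n + 1 *)
Record PG_step (Vh : set ('rV[R]_d -> R)) (Xh : set ('rV[R]_d -> 'rV[R]_d))
    (Mh : set ('rV[R]_d -> R)) (n : nat) : Prop := {
  PG_phi : forall om, Vh om ->
    dotL2 Om (ddt J tau (phi X) n) om =
    xi1 n.+1 * mxdotL2 Om (phi_velt n) (grad Om om)
    - (Peclet par)^-1 * mxdotL2 Om (grad Om (mu X n.+1)) (grad Om om);
  PG_mu : forall psi, Vh psi ->
    dotL2 Om (mu X n.+1) psi =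
    Cahn par ^+ 2 * mxdotL2 Om (grad Om (phi X n.+1)) (grad Om psi)
    + stab par * dotL2 Om (phi X n.+1) psi
    + xi1 n.+1 * dotL2 Om (dpotG n.+1) psi;
  PG_R : ddt J tau (auxR X) n =
    (2 * auxU par Om (phit X n.+1))^-1 *
    (dotL2 Om (dpotG n.+1) (ddt J tau (phi X) n)
     - mxdotL2 Om (phi_velt n) (grad Om (mu X n.+1))
     + mxdotL2 Om (phi_grad_mut n) (vel X n.+1));
  PG_vel : forall v q, Xh v -> Mh q ->
    mxdotL2 Om (fun x => sigmat n.+1 x *: ddt J tau sigmau n x) v
    + 2 / Reynolds par * mxdotL2 Om
        (fun x => etat n.+1 x *: symgrad Om (vel X n.+1) x) (symgrad Om v)
    - dotL2 Om (pres X n.+1) (div Om v)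
    + dotL2 Om (div Om (vel X n.+1)) q =
    - (xi2 n.+1 / 2) * formB n v
    - xi1 n.+1 / (Weber par * Cahn par) * mxdotL2 Om (phi_grad_mut n) v
    + (Froude par)^-1 * mxdotL2 Om (forcet n.+1) v;
  PG_Q : ddt J tau (auxQ X) n =
    - (auxQ X n.+1 / T) + 2^-1 * expt n.+1 * formB n (vel X n.+1)
}.

(* [N] is the number of time steps. *)
Record PG_solution (Vh : set ('rV[R]_d -> R))
    (Xh : set ('rV[R]_d -> 'rV[R]_d)) (Mh : set ('rV[R]_d -> R))
    (N : nat) : Prop := {
  PG_levels : forall n, (n <= N)%N ->
    [/\ Vh (phi X n), Vh (mu X n) & Xh (vel X n)];
  PG_pres : forall n, (J <= n <= N)%N -> Mh (pres X n);
  PG_phit_start : forall n, (0 < n < J)%N -> Vh (phit X n);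
  PG_phit : forall n, (J <= n.+1)%N -> phit X n.+1 = extrap J (phi X) n;
  PG_force : forall n, (J <= n <= N)%N -> L2vec Om (forcet n);
  PG_shift : forall n, (J <= n <= N)%N -> 0 < shiftedG par Om (phit X n);
  PG_equations : forall n, (J <= n.+1)%N -> (n < N)%N -> PG_step Vh Xh Mh n
}.

Definition energy n : R :=
  let a := (Weber par * Cahn par)^-1 in
  if J == 1%N then
    mxnormL2 Om (sigmau n) ^+ 2
    + Cahn par / Weber par * mxnormL2 Om (grad Om (phi X n)) ^+ 2
    + stab par * a * normL2 Om (phi X n) ^+ 2
    + 2 * a * `|auxR X n| ^+ 2
    + `|auxQ X n| ^+ 2
  else
    2^-1 * mxnormL2 Om (sigmau n) ^+ 2
    + 2^-1 * mxnormL2 Om (extrap J sigmau n) ^+ 2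
    + Cahn par / (2 * Weber par) * mxnormL2 Om (grad Om (phi X n)) ^+ 2
    + Cahn par / (2 * Weber par)
      * mxnormL2 Om (grad Om (extrap J (phi X) n)) ^+ 2
    + stab par / 2 * a * normL2 Om (phi X n) ^+ 2
    + stab par / 2 * a * normL2 Om (extrap J (phi X) n) ^+ 2
    + a * `|auxR X n| ^+ 2
    + a * `|extrap J (auxR X) n| ^+ 2
    + 2^-1 * `|auxQ X n| ^+ 2
    + 2^-1 * `|extrap J (auxQ X) n| ^+ 2.

Definition num_dissipation n : R :=
  let a := (Weber par * Cahn par)^-1 in
  if J == 1%N then
    mxnormL2 Om (diff1 sigmau n) ^+ 2
    + stab par * a * normL2 Om (diff1 (phi X) n) ^+ 2
    + Cahn par / Weber par * mxnormL2 Om (grad Om (diff1 (phi X) n)) ^+ 2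
    + 2 * a * `|diff1 (auxR X) n| ^+ 2
    + `|diff1 (auxQ X) n| ^+ 2
  else
    2^-1 * mxnormL2 Om (diff2 sigmau n) ^+ 2
    + Cahn par / (2 * Weber par) * mxnormL2 Om (grad Om (diff2 (phi X) n)) ^+ 2
    + stab par / 2 * a * normL2 Om (diff2 (phi X) n) ^+ 2
    + a * `|diff2 (auxR X) n| ^+ 2
    + 2^-1 * `|diff2 (auxQ X) n| ^+ 2.

End scheme.

(* Main.v *)
Require Import Defs.
From mathcomp Require Import all_boot all_order all_algebra.
From mathcomp Require Import all_classical all_reals all_analysis.
From mathcomp Require Import measurable_realfun ring lra.
Import Order.TTheory GRing.Theory Num.Theory.
Import numFieldNormedType.Exports.
Local Open Scope classical_set_scope.
Local Open Scope ring_scope.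
Set Implicit Arguments.
Unset Strict Implicit.
Unset Printing Implicit Defensive.

(** The law is the sum of the five equations of the scheme, tested with the new
unknowns themselves: the phase equation with [mu], the potential equation with
the difference quotient of [phi], the momentum equation with the velocity and
the pressure, and the two scalar equations with [R] and [Q]. The scheme is
built so that all the couplings then cancel. Advection, surface tension and
the nonlinear potential carry the factor [xi1 = R / U] and reappear in the
equation of [R], where they compensate; the convection form carries [xi2 = exp(t / T) Q] and
reappears in that of [Q]. What is left is the physical dissipation and, for
each unknown, the product of a difference quotient with the newest value,
which polarization turns into an energy increment plus a square
([ddt_polarization]). The final algebra is [tested_equations_balance].

The analytic content is that the integrals involved may be expanded. For
[phi], and for [sigma u] with its bounded measurable weight, this is the
bilinearity of the [L2] product. For gradients more is needed: [grad] picks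
one weak gradient, and the energy contains gradients of combinations of
several levels. So [grad] must be linear up to null sets
([mxdotL2_grad_lin]), which follows from the uniqueness of weak gradients,
hence from the fundamental lemma of the calculus of variations
([ae_zero_test_function]): an integrable function on an open set that is
orthogonal to all test functions vanishes almost everywhere.

For that lemma, smooth bumps built from [exp(-1/x)] are multiplied over the
coordinates; they converge boundedly to the indicator of an open box, so the
function has zero integral over every box whose closed hull lies in the
domain. A Dynkin argument inside one box extends this to all its measurable
subsets, and countably many boxes cover the domain. *)

(** * Flat smooth functions on the line *)

Section smooth_real_line.
Context {R : realType}.
Implicit Types (f g : R -> R) (p : {poly R}).

(** Differentiability [k] times, in an inductive form that makes each closure
property a plain induction on [k]. *)
Fixpoint Ck (k : nat) f : Prop :=
  if k is k'.+1 then
    exists2 f' : R -> R, (forall x : R, is_derive x (1 : R) f (f' x)) & Ck k' f'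
  else True.

Definition Coo f := forall k, Ck k f.

Lemma CkS k f : Ck k.+1 f -> Ck k f.
Proof.
elim: k f => //= k IH f [f' ff' Cf']; exists f' => //; exact: IH.
Qed.

Lemma Ck_cst k (c : R) : Ck k (cst c).
Proof.
elim: k c => //= k IH c; exists (cst 0) => // x; exact: is_derive_cst.
Qed.

Lemma CkD k f g : Ck k f -> Ck k g -> Ck k (f \+ g).
Proof.
elim: k f g => //= k IH f g [f' ff' Cf'] [g' gg' Cg'].
by exists (f' \+ g'); [move=> x; exact: is_deriveD | exact: IH].
Qed.

Lemma CkM k f g : Ck k f -> Ck k g -> Ck k (f \* g).
Proof.
elim: k f g => //= k IH f g [f' ff' Cf'] [g' gg' Cg'].
have Cf : Ck k f by apply: CkS; exists f'.
have Cg : Ck k g by apply: CkS; exists g'.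
exists ((f \* g') \+ (g \* f')); last by apply: CkD; exact: IH.
by move=> x; exact: is_deriveM.
Qed.

Lemma Ck_affine k f (a b : R) : Ck k f -> Ck k (fun x => f (a * x + b)).
Proof.
elim: k f => //= k IH f [f' ff' Cf'].
exists ((fun x => f' (a * x + b)) \* cst a).
  move=> x; apply: (@is_derive1_comp R f (fun x => a * x + b)) => //.
  have /= H := @is_deriveD R R R (fun x => a * x) (cst b) x 1 a 0.
  rewrite -[a in is_derive _ _ _ a]addr0; apply: H.
  have /= H := @is_deriveZ R R R id a x 1 1.
  rewrite -[a in is_derive _ _ _ a]mulr1; apply: H.
apply: CkM; [exact: IH | exact: Ck_cst].
Qed.

Lemma Coo_is_derive f : Coo f -> forall x : R, is_derive x (1 : R) f (derive1 f x).
Proof.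
move=> /(_ 1%N)[f' ff' _] x; have := ff' x => H.
by rewrite derive1E derive_val.
Qed.

Lemma Coo_derive1 f : Coo f -> Coo (derive1 f).
Proof.
move=> Cf k; have [f' ff' Cf'] := Cf k.+1.
suff -> : derive1 f = f' by [].
by apply/funext => x; have := ff' x => H; rewrite derive1E derive_val.
Qed.

(** The functions [p(1/x) exp(-1/x)], extended by zero to [x <= 0], form a class
stable under differentiation; [flat 1] is the building block of the bumps
below. *)
Definition flat p (x : R) : R := if 0 < x then p.[x^-1] * expR (- x^-1) else 0.

(** Each [y^i / i!] is at most [exp y] for [y >= 0], by the exponential series. *)
Lemma poly_expRN_bounded p :
  exists2 M : R, 0 <= M & forall y, 0 <= y -> `|p.[y] * expR (- y)| <= M.
Proof.
exists (\sum_(i < size p) `|p`_i| * i`!%:R).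
  by apply: sumr_ge0 => i _; rewrite mulr_ge0.
move=> y y0; rewrite normrM (ger0_norm (expR_ge0 _)) horner_coef.
apply: (le_trans (ler_wpM2r (expR_ge0 _) (ler_norm_sum _ _ _))).
rewrite mulr_suml; apply: ler_sum => i _.
rewrite normrM -mulrA ler_wpM2l// normrX (ger0_norm y0) expRN.
rewrite ler_pdivrMr ?expR_gt0// mulrC -ler_pdivrMr ?ltr0n ?fact_gt0//.
case: (nat_of_ord i) => [|j].
  by rewrite expr0 fact0 divr1 -expR0 ler_expR.
by apply: le_trans (expR_ge1Dxn j y0); rewrite lerDr.
Qed.

(** A zero of any finite order can be split off at the origin; this turns the
difference quotient of [flat p] at 0 into another member of the class. *)
Lemma flat_mulX p x : flat p x = flat (p * 'X) x * x.
Proof.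
rewrite /flat; case: ifPn => x0; last by rewrite mul0r.
by rewrite hornerM hornerX mulrAC -(mulrA _ x^-1) mulVf ?mulr1 ?gt_eqF.
Qed.

Lemma flat_bound p : exists2 M : R, 0 <= M & forall x, `|flat p x| <= M * `|x|.
Proof.
have [M M0 pM] := poly_expRN_bounded (p * 'X); exists M => // x.
rewrite flat_mulX normrM ler_wpM2r// /flat; case: ifPn => x0.
  by apply: pM; rewrite invr_ge0 ltW.
by rewrite normr0.
Qed.

Lemma flat_continuous0 p : {for 0, continuous (flat p)}.
Proof.
rewrite /prop_for /continuous_at [flat p 0]/flat ltxx.
have [M M0 pM] := flat_bound p.
apply/cvgrPdist_le => e e0.
near=> x; rewrite sub0r normrN (le_trans (pM x))//.
rewrite (@le_trans _ _ ((M + 1) * `|x|))// ?ler_wpM2r ?lerDl//.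
rewrite -ler_pdivlMl ?ltr_wpDl//.
near: x; apply: (@nbhs0_le R R); rewrite mulr_gt0// invr_gt0 ltr_wpDl//.
Unshelve. all: by end_near. Qed.

(** With [y = 1/x] and [dy/dx = - y^2], the product rule gives
[- y^2 p'(y) + y^2 p(y)] as the factor of [exp (- y)]. *)
Definition flat_deriv p : {poly R} := 'X^2 * (p - p^`()).

(** Away from 0 this is the chain rule. At 0, where both sides vanish, the
difference quotient is [flat (p * 'X)], which is continuous there. *)
Lemma is_derive_flat p (x : R) : is_derive x (1 : R) (flat p) (flat (flat_deriv p) x).
Proof.
have [x0|x0|->] := ltgtP x 0.
- have -> : flat (flat_deriv p) x = 0 by rewrite /flat ltNge (ltW x0).
  apply: (@near_eq_is_derive R R R (cst 0) _ x 1 0 _ (is_derive_cst _ _ _)).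
  near=> y; rewrite /flat ltNge (@ltW _ _ y)//; near: y; exact: lt_nbhsl.
- pose g (y : R) := p.[y^-1] * expR (- y^-1).
  have gE : \forall y \near x, g y = flat p y.
    near=> y; rewrite /flat ifT//; near: y; exact: lt_nbhsr.
  apply: (@near_eq_is_derive R R R _ _ x 1 _ gE).
  have -> : flat (flat_deriv p) x = (flat_deriv p).[x^-1] * expR (- x^-1).
    by rewrite /flat x0.
  have dV : is_derive x (1 : R) (fun y : R => y^-1) (- x ^- 2).
    have := @is_deriveV R id x 1 1.
    rewrite scaler1; apply; by rewrite gt_eqF.
  have dN : is_derive x (1 : R) (fun y : R => - y^-1) (x ^- 2).
    rewrite -[x ^- 2]opprK; exact: is_deriveN.
  have dp := @is_derive1_comp R _ _ x _ _ (is_derive_poly p x^-1) dV.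
  have de := @is_derive1_comp R _ _ x _ _ (is_derive_expR (- x^-1)) dN.
  have := is_deriveM dp de; rewrite /g => H.
  apply: (is_derive_eq H).
  rewrite /flat_deriv !hornerE /= /GRing.scale /= exprVn.
  ring.
- apply/is_derive1_caratheodory; exists (flat (p * 'X)); split.
  + by move=> z; rewrite [flat p 0]/flat ltxx !subr0; exact: flat_mulX.
  + exact: flat_continuous0.
  + by rewrite /flat ltxx.
Unshelve. all: by end_near. Qed.

Lemma Coo_flat p : Coo (flat p).
Proof.
move=> k; elim: k p => //= k IH p.
by exists (flat (flat_deriv p)) => // x; exact: is_derive_flat.
Qed.

End smooth_real_line.

(** * Bump functions of several variables *)

Section tensor_test_functions.
Context {R : realType} {d : nat}.
Implicit Types (b : 'I_d -> R -> R) (lo hi : 'rV[R]_d).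

(** Products of functions of one coordinate each: their iterated partial
derivatives are again such products, so that smoothness in [d] variables
reduces to smoothness on the line. *)
Definition tensor b (x : 'rV[R]_d) : R := \prod_i b i (x 0 i).

Definition derive_factor b i j : R -> R := if j == i then derive1 (b j) else b j.

(** Along the [i]-th axis only the [i]-th factor moves, so the difference quotient
is that of a function of one variable times a constant. *)
Lemma is_derive_tensor b i (x : 'rV[R]_d) : (forall j, Coo (b j)) ->
  is_derive x (delta_mx 0 i : 'rV[R]_d) (tensor b) (tensor (derive_factor b i) x).
Proof.
move=> bC.
pose C : R := \prod_(j | j != i) b j (x 0 j).
pose f := (fun y => b i y * C).
have fd : is_derive (x 0 i) (1 : R) f (derive1 (b i) (x 0 i) * C).
  have bd := Coo_is_derive (bC i) (x 0 i).
  have := is_deriveM bd (is_derive_cst C (x 0 i) 1) => H.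
  by apply: (is_derive_eq H); rewrite scaler0 add0r /GRing.scale/= mulrC.
have -> : tensor (derive_factor b i) x = derive1 (b i) (x 0 i) * C.
  rewrite /tensor (bigD1 i)//= /derive_factor eqxx; congr (_ * _).
  by apply: eq_bigr => j /negbTE ->.
have E : (fun h : R => h^-1 *: ((tensor b \o shift x) (h *: delta_mx 0 i) - tensor b x))
    = (fun h : R => h^-1 *: ((f \o shift (x 0 i)) (h *: 1) - f (x 0 i))).
  apply/funext => h; congr (_ *: (_ - _)).
    rewrite /= /tensor (bigD1 i)//= !mxE !eqxx /f; congr (_ * _).
    by apply: eq_bigr => j /negbTE ji; rewrite !mxE ji andbF mulr0 add0r.
  by rewrite /tensor (bigD1 i).
have := fd => -[]; rewrite /derivable /derive -E => fd1 fd2.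
by split.
Qed.

Lemma partial_tensor b i : (forall j, Coo (b j)) ->
  partial i (tensor b) = tensor (derive_factor b i).
Proof.
move=> bC; apply/funext => x; have H := is_derive_tensor i x bC.
by rewrite /partial derive_val.
Qed.

Lemma continuous_tensor b : (forall j, Coo (b j)) -> continuous (tensor b).
Proof.
move=> bC; apply: (@continuous_big R 'I_d *%R 1 xpredT (@mul_continuous R) 'rV[R]_d _
  (fun i (x : 'rV[R]_d) => b i (x 0 i))) => i _ x.
apply: (@continuous_comp _ _ _ (fun y : 'rV[R]_d => y 0 i) (b i)).
  exact: coord_continuous.
apply/differentiable_continuous/derivable1_diffP.
by have := Coo_is_derive (bC i) (x 0 i) => -[].
Qed.

Lemma smooth_tensor b : (forall j, Coo (b j)) -> smooth (tensor b).
Proof.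
move=> bC s /=.
suff [c cC ->] : exists2 c, (forall j, Coo (c j)) & foldr partial (tensor b) s = tensor c.
  split; first exact: continuous_tensor.
  by move=> i x; have [] := is_derive_tensor i x cC.
elim: s => [|i s [c cC /= ->]]; first by exists b.
exists (derive_factor c i); last exact: partial_tensor.
by move=> j; rewrite /derive_factor; case: ifP => // _; exact: Coo_derive1.
Qed.

Definition obox lo hi : set 'rV[R]_d := [set x | forall i, lo 0 i < x 0 i < hi 0 i].

Definition cbox lo hi : set 'rV[R]_d := [set x | forall i, lo 0 i <= x 0 i <= hi 0 i].

Lemma compact_cbox lo hi : compact (cbox lo hi).
Proof.
have := @rV_compact R d (fun i => `[lo 0 i, hi 0 i]%classic)
  (fun i => @segment_compact R _ _).
by congr compact; apply/seteqP; split=> x /= H i; have := H i; rewrite in_itv.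
Qed.

(** The factor [exp (- 1 / (m (y - lo))) exp (- 1 / (m (hi - y)))], with
[m = k + 1], tends to 1 inside the interval as [k] grows and vanishes outside
of it.
Hence a single smooth profile approximates the indicators of all boxes, with
supports that do not grow. *)
Definition bump lo hi (k : nat) : 'rV[R]_d -> R :=
  tensor (fun i y => flat 1 (k.+1%:R * y + - (k.+1%:R * lo 0 i)) *
                     flat 1 (- k.+1%:R * y + k.+1%:R * hi 0 i)).

Lemma test_function_bump lo hi k (Om : set 'rV[R]_d) :
  cbox lo hi `<=` Om -> test_function Om (bump lo hi k).
Proof.
move=> sub; split.
  apply: smooth_tensor => j m; apply: CkM; apply: Ck_affine; exact: Coo_flat.
exists (cbox lo hi); split => //.
  exact: compact_cbox.
move=> x /= /existsNP[i /negP]; rewrite negb_and -!ltNge => xi.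
rewrite /bump /tensor (bigD1 i)//= /flat.
case/orP: xi => xi; apply/eqP; rewrite !mulf_eq0; apply/orP; left.
  rewrite ifN ?mul0r ?eqxx// -leNgt -mulrBr pmulr_rle0 ?ltr0n// subr_le0.
  exact: ltW.
rewrite orbC ifN ?mul0r ?eqxx// -leNgt addrC mulNr -mulrBr pmulr_rle0 ?ltr0n//.
by rewrite subr_le0 ltW.
Qed.

Lemma flat1_itv (y : R) : 0 <= flat 1 y <= 1.
Proof.
rewrite /flat; case: ifPn => y0; last by rewrite lexx ler01.
by rewrite hornerE mul1r expR_ge0 expR_le1 oppr_le0 invr_ge0 ltW.
Qed.

Lemma bump_itv lo hi k x : 0 <= bump lo hi k x <= 1.
Proof.
rewrite /bump /tensor.
elim/big_ind : _ => [|a b /andP[a0 a1] /andP[b0 b1]|i _].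
- by rewrite ler01 lexx.
- by rewrite mulr_ge0// mulr_ile1.
have /andP[a0 a1] := flat1_itv (k.+1%:R * x 0 i + - (k.+1%:R * lo 0 i)).
have /andP[b0 b1] := flat1_itv (- k.+1%:R * x 0 i + k.+1%:R * hi 0 i).
by rewrite mulr_ge0// mulr_ile1.
Qed.

Lemma cvg_flat1_scale (y : R) :
  flat 1 (k.+1%:R * y) @[k --> \oo] --> ((0 < y)%R%:R : R).
Proof.
case: ltP => y0; last first.
  apply: cvg_near_cst; apply: nearW => k; rewrite /flat ifN//.
  by rewrite -leNgt pmulr_rle0 ?ltr0n.
have -> : (fun k : nat => flat 1 (k.+1%:R * y)) =
    (fun k : nat => expR (- (k.+1%:R^-1 * y^-1))).
  apply/funext => k; rewrite /flat ifT ?pmulr_rgt0 ?ltr0n//.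
  by rewrite hornerE mul1r invfM.
rewrite mulr1n -[in X in _ --> X](@expR0 R).
apply: (@cvg_comp _ _ _ (fun k : nat => - (k.+1%:R^-1 * y^-1)) expR _ (nbhs (0 : R)));
  last exact: continuous_expR.
rewrite -oppr0; apply: cvgN; rewrite -(mul0r y^-1).
by apply: cvgMl; exact: cvg_harmonic.
Qed.

Lemma cvg_bump lo hi x :
  bump lo hi k x @[k --> \oo] --> (\1_(obox lo hi) x : R).
Proof.
have -> : \1_(obox lo hi) x = \prod_i
    (((0 < x 0 i - lo 0 i)%R%:R : R) * (0 < hi 0 i - x 0 i)%R%:R).
  rewrite indicE; case: (boolP (x \in obox lo hi)) => [/set_mem xB|].
    by rewrite big1// => i _; have /andP[lx xh] := xB i; rewrite !subr_gt0 lx xh mulr1.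
  rewrite notin_setE => /existsNP[i /negP]; rewrite negb_and => xi.
  rewrite (bigD1 i)//= !subr_gt0.
  by case/orP: xi => /negbTE ->; rewrite ?mulr0 ?mul0r.
apply: (@cvg_big R 'I_d *%R 1 xpredT (@mul_continuous R)) => i _.
have e1 (k : nat) : k.+1%:R * x 0 i + - (k.+1%:R * lo 0 i) = k.+1%:R * (x 0 i - lo 0 i).
  by rewrite mulrBr.
have e2 (k : nat) : - k.+1%:R * x 0 i + k.+1%:R * hi 0 i = k.+1%:R * (hi 0 i - x 0 i).
  by rewrite mulrBr addrC mulNr.
under eq_fun do rewrite e1 e2.
by apply: cvgM; exact: cvg_flat1_scale.
Qed.

End tensor_test_functions.

(** * Boxes and open sets *)

Section measurable_boxes.
Context {R : realType} {d : nat}.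
Implicit Types (lo hi : 'rV[R]_d) (A : set 'rV[R]_d).

Lemma measurable_obox lo hi : measurable (obox lo hi).
Proof.
have -> : obox lo hi = \big[setI/setT]_(i < d)
    ((fun x : 'rV[R]_d => x 0 i) @^-1` `]lo 0 i, hi 0 i[%classic).
  rewrite -bigcap_seq; apply/seteqP; split => [x Ax i _|x Ax i] /=.
    by rewrite in_itv/=; exact: Ax.
  by have := Ax i; rewrite /= in_itv/=; apply; rewrite mem_index_enum.
apply: bigsetI_measurable => i _.
have := @measurable_coor R d i measurableT _ (measurable_itv `]lo 0 i, hi 0 i[).
by rewrite setTI.
Qed.

(** The boxes are those with rational corners and closed hull inside [A]. The
closed hull is kept because test functions need compact support in [A]. *)
Lemma open_bigcup_obox A : open A ->
  exists2 F : nat -> set 'rV[R]_d,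
    (forall k, F k = set0 \/ exists lo hi, F k = obox lo hi /\ cbox lo hi `<=` A) &
    A = \bigcup_k F k.
Proof.
move=> oA.
pose box (p : 'rV[rat]_d * 'rV[rat]_d) :=
  obox (map_mx (@ratr R) p.1) (map_mx (@ratr R) p.2).
pose cb (p : 'rV[rat]_d * 'rV[rat]_d) :=
  cbox (map_mx (@ratr R) p.1) (map_mx (@ratr R) p.2).
pose F k := if unpickle k is Some p then
  if `[< cb p `<=` A >] then box p else set0 else set0.
exists F.
  move=> k; rewrite /F; case: unpickle => [p|]; last by left.
  case: asboolP => // pA; [right|by left].
  by exists (map_mx (@ratr R) p.1), (map_mx (@ratr R) p.2).
apply/seteqP; split => x; last first.
  move=> [k _]; rewrite /F; case: unpickle => // p; case: asboolP => // pA xB.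
  by apply: pA => i; have /andP[a b] := xB i; rewrite !ltW.
move=> Ax; have /nbhs_ballP[e /= e0 xeA] : nbhs x A by exact: open_nbhs_nbhs.
have lo_ex i : exists q : rat, ratr q \in `]x 0 i - e, x 0 i[.
  by apply: rat_in_itvoo; rewrite ltrBlDr ltrDl.
have hi_ex i : exists q : rat, ratr q \in `]x 0 i, x 0 i + e[.
  by apply: rat_in_itvoo; rewrite ltrDl.
pose lo : 'rV[rat]_d := \row_i xchoose (lo_ex i).
pose hi : 'rV[rat]_d := \row_i xchoose (hi_ex i).
exists (pickle (lo, hi)) => //; rewrite /F pickleK.
have loP i : x 0 i - e < ratr (xchoose (lo_ex i)) < x 0 i.
  by have := xchooseP (lo_ex i); rewrite in_itv.
have hiP i : x 0 i < ratr (xchoose (hi_ex i)) < x 0 i + e.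
  by have := xchooseP (hi_ex i); rewrite in_itv.
case: asboolP => [_|[]].
  move=> i; rewrite !mxE /=.
  by have /andP[_ ->] := loP i; have /andP[-> _] := hiP i.
move=> y yB; apply: xeA; split => // i j; rewrite (ord1 i).
have /andP[la lb] := loP j; have /andP[ha hb] := hiP j.
have := yB j; rewrite !mxE => /andP[ya yb].
rewrite /ball /= ltr_distlC; apply/andP; split.
  exact: lt_le_trans ya.
exact: le_lt_trans hb.
Qed.

Lemma measurable_open_rV A : open A -> measurable A.
Proof.
move=> /open_bigcup_obox[F FA ->]; apply: bigcupT_measurable => k.
have [->|[lo [hi [-> _]]]] := FA k; [exact: measurable0|exact: measurable_obox].
Qed.

Lemma measurable_continuous_rV (f : 'rV[R]_d -> R) :
  continuous f -> measurable_fun [set: 'rV[R]_d] f.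
Proof.
move=> /continuousP cf.
apply: (measurability _ (RGenOInfty.measurableE R)) => //.
move=> _ [_ [c ->] <-]; rewrite setTI; apply: measurable_open_rV.
by apply: cf; exact: interval_open.
Qed.

Lemma measurable_cbox lo hi : measurable (cbox lo hi).
Proof.
have cl : closed (cbox lo hi).
  by apply: compact_closed; [exact: norm_hausdorff|exact: compact_cbox].
have := measurable_open_rV (closed_openC cl) => /measurableC.
by rewrite setCK.
Qed.

Lemma bounded_sub_cbox A : bounded_set A ->
  exists M : R, A `<=` cbox (const_mx (- M)) (const_mx M).
Proof.
move=> [M [Mreal AM]]; exists (M + 1) => x Ax i.
rewrite !mxE -ler_norml.
have Ml : M < M + 1 by rewrite ltrDl.
apply: le_trans (AM _ Ml _ Ax).
rewrite /Num.norm/= mx_normrE.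
exact: (@le_bigmax _ _ _ 0 (fun ij : 'I_1 * 'I_d => `|x ij.1 ij.2|) (0, i)).
Qed.

Lemma lebesgue_rV_cbox_lty (M : R) :
  (lebesgue_rV d (cbox (const_mx (- M)%R) (const_mx M)) < +oo)%E.
Proof.
have -> : cbox (const_mx (- M)) (const_mx M) =
    [set x : 'rV[R]_d | forall i, (fun=> `[- M, M]%classic) i (x 0 i)].
  by apply/seteqP; split=> x /= H i; have := H i; rewrite /= in_itv/= !mxE.
rewrite (@lebesgue_rV_box R d (fun=> `[- M, M]%classic)) => [|i]; last first.
  exact: measurable_itv.
have Mfin : (\prod_(i < d) lebesgue_measure `[(- M)%R, M]%classic)%E \is a fin_num.
  apply: prode_fin_num => i _; rewrite lebesgue_measure_itv/=.
  by case: ifP.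
by rewrite ltey_eq Mfin.
Qed.

End measurable_boxes.

(** * The fundamental lemma of the calculus of variations *)

Section fundamental_lemma.
Context {R : realType} {d : nat}.
Local Notation leb := (@lebesgue_rV R d).

(** Orthants are stable under intersection, generate the Borel sets, and meet an
open box in an open box: this makes them fit for a Dynkin argument localised
to one box. *)
Definition orthants : set (set 'rV[R]_d) :=
  [set [set x : 'rV[R]_d | forall i, lo 0 i < x 0 i] | lo in [set: 'rV[R]_d]].

Lemma orthants_setI_closed : setI_closed orthants.
Proof.
move=> _ _ [a _ <-] [b _ <-]; exists (\row_i Num.max (a 0 i) (b 0 i)) => //.
apply/seteqP; split => [x /= H|x /= [Ha Hb] i].
  by split=> i; have := H i; rewrite mxE gt_max => /andP[].
by rewrite mxE gt_max Ha Hb.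
Qed.

Lemma measurable_orthants : @measurable _ 'rV[R]_d = <<s orthants >>.
Proof.
apply/seteqP; split; last first.
  apply: smallest_sub; first exact: sigma_algebra_measurable.
  move=> _ [lo _ <-].
  have -> : [set x : 'rV[R]_d | forall i, lo 0 i < x 0 i] = \big[setI/setT]_(i < d)
      ((fun x : 'rV[R]_d => x 0 i) @^-1` `]lo 0 i, +oo[%classic).
    rewrite -bigcap_seq; apply/seteqP; split => [x Ax i _|x Ax i] /=.
      by rewrite in_itv/= andbT; exact: Ax.
    by have := Ax i; rewrite /= in_itv/= andbT; apply; rewrite mem_index_enum.
  apply: bigsetI_measurable => i _.
  have := @measurable_coor R d i measurableT _ (measurable_itv `]lo 0 i, +oo[).
  by rewrite setTI.
apply: smallest_sub; first exact: smallest_sigma_algebra.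
rewrite -bigcup_seq; apply: bigcup_sub => i _ A [C mC <-].
have : measurable_fun [set: g_sigma_algebraType orthants] (fun x : 'rV[R]_d => x 0 i).
  apply: (measurability _ (RGenOInfty.measurableE R)) => //.
  move=> _ [_ [c ->] <-]; rewrite setTI.
  (* A half-space is the increasing union of the orthants whose other sides
     recede to minus infinity. *)
  have -> : (fun x : 'rV[R]_d => x 0 i) @^-1` `]c, +oo[%classic =
     \bigcup_(k : nat) [set x : 'rV[R]_d | forall j,
         (\row_j (if j == i then c else - k%:R)) 0 j < x 0 j].
    apply/seteqP; split => [x /=|x [k _ /= /(_ i)]]; last first.
      by rewrite mxE eqxx in_itv/= andbT.
    rewrite in_itv/= andbT => cx.
    have [k Hk] : exists k : nat, forall j, `|x 0 j| < k%:R.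
      have [M HM] := @bounded_sub_cbox R d [set x]
        (@compact_bounded _ _ _ (@compact_set1 _ x)).
      have Mx j : `|x 0 j| <= M.
        by have := HM x erefl j; rewrite !mxE ler_norml.
      exists (Num.truncn `|M|).+1 => j; apply: le_lt_trans (Mx j) _.
      by apply: le_lt_trans (ler_norm _) _; exact: truncnS_gt.
    exists k => // j; rewrite mxE; case: eqP => [->//|_].
    by have := Hk j; rewrite ltr_norml => /andP[].
  apply: bigcupT_measurable => k; apply: sub_sigma_algebra.
  by eexists.
by move=> /(_ measurableT C mC); rewrite !setTI.
Qed.

(** Dominated convergence along the bumps of the box. *)
Lemma integral_obox0 (Om : set 'rV[R]_d) (g : 'rV[R]_d -> R) lo hi :
  measurable Om -> leb.-integrable Om (EFin \o g) ->
  (forall psi, test_function Om psi -> vint Om (fun x => g x * psi x) = 0) ->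
  cbox lo hi `<=` Om -> (\int[leb]_(x in obox lo hi) (g x)%:E = 0)%E.
Proof.
move=> mOm ig gpsi sub.
have mg : measurable_fun Om g by apply/measurable_EFinP; case/integrableP : ig.
have mb k : measurable_fun Om (bump lo hi k).
  apply: measurable_funTS; apply: measurable_continuous_rV.
  by have [sb _] := test_function_bump k sub; exact: (sb [::]).1.
have igb k : leb.-integrable Om (fun x => (g x * bump lo hi k x)%:E).
  apply: le_integrable ig => //.
    by apply/measurable_EFinP; exact: measurable_funM.
  move=> x _ /=; rewrite lee_fin normrM ler_piMr//.
  by have /andP[a b] := bump_itv lo hi k x; rewrite ger0_norm.
have int0 k : (\int[leb]_(x in Om) (g x * bump lo hi k x)%:E = 0)%E.
  have := gpsi _ (test_function_bump k sub); rewrite /vint /Rintegral => H.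
  by rewrite -[LHS]fineK ?H//; exact: integrable_fin_num.
have mlim : measurable_fun Om (fun x => (g x * \1_(obox lo hi) x)%:E).
  apply/measurable_EFinP; apply: measurable_funM => //.
  by apply: measurable_indic; exact: measurable_obox.
have clim : {ae leb, forall x, Om x ->
    (g x * bump lo hi k x)%:E @[k --> \oo] --> (g x * \1_(obox lo hi) x)%:E}.
  apply: aeW => x _; apply: cvg_EFin; first exact: nearW.
  by apply: cvgMr; exact: cvg_bump.
have dom : {ae leb, forall x k, Om x ->
    (`|(g x * bump lo hi k x)%:E| <= `|(g x)%:E|)%E}.
  apply: aeW => x k _; rewrite /= lee_fin normrM ler_piMr//.
  by have /andP[a b] := bump_itv lo hi k x; rewrite ger0_norm.
have [_ _ lim] := dominated_convergence mOm (fun k => measurable_int _ (igb k))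
  mlim clim (integrable_abse ig) dom.
have -> : (\int[leb]_(x in obox lo hi) (g x)%:E =
           \int[leb]_(x in Om) (g x * \1_(obox lo hi) x)%:E)%E.
  have {1}-> : obox lo hi = Om `&` obox lo hi.
    apply/esym/setIidr => x xB; apply: sub => i.
    by have /andP[a b] := xB i; rewrite !ltW.
  rewrite integral_mkcondr; apply: eq_integral => x _.
  by rewrite patchE indicE; case: ifP => _; rewrite ?mulr1 ?mulr0.
have lim0 : (\int[leb]_(x in Om) (g x * bump lo hi k x)%:E)%E @[k --> \oo]
    --> (0 : \bar R)%E.
  by apply: cvg_near_cst; exact: nearW.
by apply/esym; exact: (cvg_unique _ lim0 lim).
Qed.

(** The sets [E] over which [g] has zero integral within the box form a Dynkin
system containing the orthants, hence all measurable sets. *)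
Lemma ae_zero_obox (g : 'rV[R]_d -> R) lo hi :
  leb.-integrable (obox lo hi) (EFin \o g) ->
  (forall lo' hi', obox lo' hi' `<=` obox lo hi -> cbox lo' hi' `<=` cbox lo hi ->
     (\int[leb]_(x in obox lo' hi') (g x)%:E = 0)%E) ->
  leb.-negligible [set x | obox lo hi x /\ g x != 0].
Proof.
set B := obox lo hi => ig g0; have mB : measurable B by exact: measurable_obox.
have igE E : measurable E -> leb.-integrable (E `&` B) (EFin \o g).
  move=> mE; apply: integrableS ig => //; exact: measurableI.
have allE E : measurable E -> (\int[leb]_(x in E `&` B) (g x)%:E = 0)%E.
  move=> mE; have : <<s orthants >> E by rewrite -measurable_orthants.
  pose P (E : set 'rV[R]_d) := (\int[leb]_(x in E `&` B) (g x)%:E = 0)%E.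
  apply: (@dynkin_induction _ _ orthants P).
  - exact: measurable_orthants.
  - exact: orthants_setI_closed.
  - by rewrite /P setTI; exact: g0.
  - move=> _ [c _ <-]; rewrite /P.
    set lo' : 'rV[R]_d := \row_i Num.max (lo 0 i) (c 0 i).
    have -> : [set x : 'rV[R]_d | forall i, c 0 i < x 0 i] `&` B = obox lo' hi.
      apply/seteqP; split => [x [/= cx xB] i|x xB].
        by rewrite mxE gt_max cx andbT; exact: xB.
      split=> i; have := xB i; rewrite mxE gt_max => /andP[/andP[a b] e] //.
      by rewrite a e.
    apply: g0 => x xB i; have := xB i; rewrite mxE.
      by rewrite gt_max => /andP[/andP[-> _] ->].
    by rewrite ge_max => /andP[/andP[-> _] ->].
  - move=> S mS PS; rewrite /P.
    have : (\int[leb]_(x in B) (g x)%:E = 0)%E by exact: g0.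
    have BE : B = (S `&` B) `|` (~` S `&` B) by rewrite -setIUl setUv setTI.
    rewrite {1}BE integral_setU//; first by rewrite PS add0e.
    + exact: measurableI.
    + by apply: measurableI => //; exact: measurableC.
    + by rewrite -BE; case/integrableP: ig.
    + by apply/disj_setPS => x [[Sx _] [nSx _]].
  - move=> F mF tF PF; rewrite /P setI_bigcupl integral_bigcup.
    + by rewrite eseries0// => k _ _; exact: PF.
    + by apply: trivIset_setIr.
    + by move=> k; exact: measurableI.
    + rewrite -setI_bigcupl; apply: igE; exact: bigcupT_measurable.
have : ae_eq leb B (EFin \o g) (cst 0%E).
  apply: integral_ae_eq => // E EB mE; rewrite integral0.
  by rewrite -[E](@setIidl _ _ B)// allE.
move=> /negligibleS; apply => x /= [Bx gx0] /(_ Bx) [] /eqP.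
by rewrite (negbTE gx0).
Qed.

(** The fundamental lemma of the calculus of variations. It is what makes weak
gradients unique almost everywhere. *)
Lemma ae_zero_test_function (Om : set 'rV[R]_d) (g : 'rV[R]_d -> R) :
  open Om -> leb.-integrable Om (EFin \o g) ->
  (forall psi, test_function Om psi -> vint Om (fun x => g x * psi x) = 0) ->
  ae_zero Om g.
Proof.
move=> oOm ig gpsi; have mOm := measurable_open_rV oOm.
have [F FP OmE] := open_bigcup_obox oOm.
have : leb.-negligible (\bigcup_k [set x | F k x /\ g x != 0]).
  apply: negligible_bigcup => k.
  have [->|[lo [hi [-> sub]]]] := FP k.
    by apply: (negligibleS _ (negligible_set0 _)) => x [].
  have oc : obox lo hi `<=` cbox lo hi.
    by move=> x xB i; have /andP[a b] := xB i; rewrite !ltW.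
  apply: ae_zero_obox.
    apply: integrableS ig => //; first exact: measurable_obox.
    exact: subset_trans sub.
  move=> lo' hi' _ sub'; apply: integral_obox0 gpsi _ => //.
  exact: subset_trans sub.
move=> /negligibleS; apply => x /= /not_implyP[]; rewrite OmE => -[k _ Fx] gx.
by exists k => //; split => //; exact/eqP.
Qed.

End fundamental_lemma.

(** * Polarization of difference quotients *)

Section linear_closure.
Context {R : realType} {V : lmodType R}.
Variable S : set V.
Hypothesis S_lin : forall a f g, S f -> S g -> S (a *: f + g).

Lemma lin_closed0 f : S f -> S 0.
Proof. by move=> Sf; have := S_lin (-1) Sf Sf; rewrite scaleN1r addNr. Qed.

Lemma lin_closedZ a f : S f -> S (a *: f).
Proof. by move=> Sf; have := S_lin a Sf (lin_closed0 Sf); rewrite addr0. Qed.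

Lemma lin_closedN f : S f -> S (- f).
Proof. by move=> Sf; rewrite -scaleN1r; exact: lin_closedZ. Qed.

Lemma lin_closedD f g : S f -> S g -> S (f + g).
Proof. by move=> Sf Sg; have := S_lin 1 Sf Sg; rewrite scale1r. Qed.

End linear_closure.

Section polarization.
Context {R : realType} {V : lmodType R}.
Variables (S : set V) (b : V -> V -> R).
Hypothesis S_lin : forall a f g, S f -> S g -> S (a *: f + g).
Hypothesis b_sym : forall f g, b f g = b g f.
Hypothesis b_lin : forall a f g h, S f -> S g -> S h ->
  b (a *: f + g) h = a * b f h + b g h.

Let SN f : S f -> S (- f).
Proof. exact: lin_closedN. Qed.

Let SD f g : S f -> S g -> S (f + g).
Proof. exact: lin_closedD. Qed.

Let SZ a f : S f -> S (a *: f).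
Proof. exact: lin_closedZ. Qed.

Let bD f g h : S f -> S g -> S h -> b (f + g) h = b f h + b g h.
Proof. by move=> Sf Sg Sh; have := b_lin 1 Sf Sg Sh; rewrite scale1r mul1r. Qed.

Let bN f h : S f -> S h -> b (- f) h = - b f h.
Proof.
move=> Sf Sh; have := b_lin (-1) Sf Sf Sh; have := bD Sf (SN Sf) Sh.
rewrite scaleN1r mulN1r !addNr addrN => -> H.
by apply/eqP; rewrite -addr_eq0 addrC H.
Qed.

Let bZ a f h : S f -> S h -> b (a *: f) h = a * b f h.
Proof.
move=> Sf Sh; have := b_lin a Sf Sf Sh.
by rewrite bD//; [move=> /addIr|exact: SZ].
Qed.

Let bDr f g h : S f -> S g -> S h -> b h (f + g) = b h f + b h g.
Proof. by move=> *; rewrite b_sym bD// !(b_sym h). Qed.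

Let bNr f h : S f -> S h -> b h (- f) = - b h f.
Proof. by move=> *; rewrite b_sym bN// (b_sym h). Qed.

Let bZr a f h : S f -> S h -> b h (a *: f) = a * b h f.
Proof. by move=> *; rewrite b_sym bZ// (b_sym h). Qed.

(** The energy of the scheme is a weighted sum of such terms over the unknowns,
and its numerical dissipation is the sum of the [step_loss] terms with the
same weights; these weights are the same for both values of [J]. *)
Definition step_energy (J : nat) (chi : nat -> V) n : R :=
  if J == 1%N then b (chi n) (chi n)
  else 2^-1 * (b (chi n) (chi n) + b (extrap J chi n) (extrap J chi n)).

Definition step_loss (J : nat) (chi : nat -> V) n : R :=
  if J == 1%N then b (diff1 chi n) (diff1 chi n)
  else 2^-1 * b (diff2 chi n) (diff2 chi n).

(** These are the identities
[2 (x, x - y) = |x|^2 - |y|^2 + |x - y|^2] and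
[2 (x, 3/2 x - 2 y + 1/2 z) = 1/2 (|x|^2 + |2 x - y|^2 - |y|^2 - |2 y - z|^2
+ |x - 2 y + z|^2)],
which make testing a difference quotient with the newest value produce an
exact energy increment plus a square. The form is only required to be bilinear
on [S], since integrals are additive on integrable functions only. *)
Lemma ddt_polarization (J : nat) (chi : nat -> V) (tau : R) n :
  tau != 0 -> J = 1%N \/ J = 2%N -> (J <= n.+1)%N ->
  (forall k, (k <= n.+1)%N -> S (chi k)) ->
  2 * tau * b (ddt J tau chi n) (chi n.+1) =
  step_energy J chi n.+1 - step_energy J chi n + step_loss J chi n.+1.
Proof.
move=> tau0 J12 Jn Schi.
have Sn1 := Schi _ (leqnn n.+1); have Sn := Schi _ (leqnSn n).
rewrite /step_energy /step_loss /ddt /gamma0 /hatted /extrap /diff1 /diff2.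
case: J12 Jn => -> /= n1.
  rewrite scale1r.
  rewrite !(bD, bN, bZ, bDr, bNr, bZr);
    try by repeat (assumption || apply: SD || apply: SN || apply: SZ).
  rewrite (b_sym (chi n) (chi n.+1)).
  by field.
have Sn0 : S (chi n.-1) by apply: Schi; exact: leq_trans (leq_pred n) (leqnSn n).
rewrite !(bD, bN, bZ, bDr, bNr, bZr);
    try by repeat (assumption || apply: SD || apply: SN || apply: SZ).
rewrite (b_sym (chi n) (chi n.+1)) (b_sym (chi n.-1) (chi n.+1)).
rewrite (b_sym (chi n.-1) (chi n)).
by field.
Qed.

End polarization.

(** * Square integrable functions *)

Section L2_forms.
Context {R : realType} {d : nat} {Om : set 'rV[R]_d}.
Hypothesis mOm : measurable Om.
Local Notation leb := (@lebesgue_rV R d).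
Implicit Types (f g : 'rV[R]_d -> R) (u v w : 'rV[R]_d -> 'rV[R]_d).

Lemma L2M_integrable f g : L2 Om f -> L2 Om g ->
  leb.-integrable Om (EFin \o (fun x => f x * g x)).
Proof.
move=> [mf if2] [mg ig2].
apply: le_integrable (integrableD mOm if2 ig2) => //.
  by apply/measurable_EFinP; exact: measurable_funM.
move=> x _ /=; rewrite lee_fin normrM (ger0_norm (addr_ge0 (sqr_ge0 _) (sqr_ge0 _))).
rewrite -[f x ^+ 2]real_normK ?num_real// -[g x ^+ 2]real_normK ?num_real//.
have := sqr_ge0 (`|f x| - `|g x|); have := normr_ge0 (f x); have := normr_ge0 (g x).
nra.
Qed.

Lemma L2_lin (a : R) f g : L2 Om f -> L2 Om g -> L2 Om (a *: f + g).
Proof.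
move=> Lf Lg; have [mf if2] := Lf; have [mg ig2] := Lg.
have mafg : measurable_fun Om (a *: f + g).
  by apply: measurable_funD => //; apply: measurable_funM => //; exact: measurable_cst.
split => //.
have i1 := integrableZl mOm (2 * a ^+ 2) if2.
have i2 := integrableZl mOm 2 ig2.
apply: le_integrable (integrableD mOm i1 i2) => //.
  by apply/measurable_EFinP; exact: measurable_funX.
move=> x _ /=; rewrite lee_fin.
rewrite -[(a *: f + g) x]/(a * f x + g x).
rewrite ger0_norm ?sqr_ge0//; apply: le_trans (ler_norm _).
have := sqr_ge0 (a * f x - g x); nra.
Qed.

Lemma L2_mul_bounded (c : 'rV[R]_d -> R) (M : R) f :
  measurable_fun Om c -> (forall x, `|c x| <= M) -> L2 Om f ->
  L2 Om (fun x => c x * f x).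
Proof.
move=> mc cM [mf if2]; split; first exact: measurable_funM.
apply: le_integrable (integrableZl mOm (M ^+ 2) if2) => //.
  by apply/measurable_EFinP; apply: measurable_funX; exact: measurable_funM.
move=> x _ /=; rewrite lee_fin ger0_norm ?sqr_ge0//; apply: le_trans (ler_norm _).
rewrite exprMn ler_wpM2r ?sqr_ge0// -[c x ^+ 2]real_normK ?num_real//.
have M0 : 0 <= M := le_trans (normr_ge0 _) (cM x).
by rewrite lerXn2r ?nnegrE.
Qed.

Lemma dotL2C f g : dotL2 Om f g = dotL2 Om g f.
Proof. by rewrite /dotL2; congr vint; apply/funext => x; rewrite mulrC. Qed.

Lemma dotL2_lin (a : R) f g h : L2 Om f -> L2 Om g -> L2 Om h ->
  dotL2 Om (a *: f + g) h = a * dotL2 Om f h + dotL2 Om g h.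
Proof.
move=> Lf Lg Lh; have ifh := L2M_integrable Lf Lh; have igh := L2M_integrable Lg Lh.
rewrite /dotL2 /vint -RintegralZl// -RintegralD//; last first.
  exact: (integrableZl mOm a ifh).
apply: eq_Rintegral => x _.
by rewrite -[(a *: f + g) x]/(a * f x + g x) mulrDl mulrA.
Qed.

Lemma mxdotL2C (p q : nat) (A B : 'rV[R]_d -> 'M[R]_(p, q)) :
  mxdotL2 Om A B = mxdotL2 Om B A.
Proof.
rewrite /mxdotL2; congr vint; apply/funext => x.
by apply: eq_bigr => i _; apply: eq_bigr => j _; rewrite mulrC.
Qed.

Lemma dotL2_ge0 f : 0 <= dotL2 Om f f.
Proof. by apply: Rintegral_ge0 => x _; rewrite -expr2 sqr_ge0. Qed.

Lemma mxdotL2_ge0 (p q : nat) (A : 'rV[R]_d -> 'M[R]_(p, q)) :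
  0 <= mxdotL2 Om A A.
Proof.
apply: Rintegral_ge0 => x _.
by apply: sumr_ge0 => i _; apply: sumr_ge0 => j _; rewrite -expr2 sqr_ge0.
Qed.

Lemma mxnormL2_sqr (p q : nat) (A : 'rV[R]_d -> 'M[R]_(p, q)) :
  mxnormL2 Om A ^+ 2 = mxdotL2 Om A A.
Proof. by rewrite sqr_sqrtr// mxdotL2_ge0. Qed.

Lemma mxdotL2_integrable u w : L2vec Om u -> L2vec Om w ->
  leb.-integrable Om (EFin \o (fun x => \sum_i \sum_j u x i j * w x i j)).
Proof.
move=> Lu Lw.
have -> : EFin \o (fun x => \sum_i \sum_j u x i j * w x i j) =
    (fun x => \sum_(j < d) (u x 0 j * w x 0 j)%:E)%E.
  by apply/funext => x /=; rewrite big_ord1 sumEFin.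
by apply: integrable_sum => // j _; exact: (L2M_integrable (Lu j) (Lw j)).
Qed.

Lemma L2vec_lin (a : R) u v : L2vec Om u -> L2vec Om v -> L2vec Om (a *: u + v).
Proof.
move=> Lu Lv i; have := L2_lin a (Lu i) (Lv i).
by congr (L2 Om); apply/funext => x; rewrite !fctE !mxE.
Qed.

Lemma mxdotL2_lin (a : R) u v w : L2vec Om u -> L2vec Om v -> L2vec Om w ->
  mxdotL2 Om (a *: u + v) w = a * mxdotL2 Om u w + mxdotL2 Om v w.
Proof.
move=> Lu Lv Lw; have iu := mxdotL2_integrable Lu Lw; have iv := mxdotL2_integrable Lv Lw.
rewrite /mxdotL2 /vint -RintegralZl// -RintegralD//; last first.
  exact: (integrableZl mOm a iu).
apply: eq_Rintegral => x _; rewrite !big_ord1 mulr_sumr -big_split/=.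
by apply: eq_bigr => j _; rewrite !fctE !mxE mulrDl mulrA.
Qed.

Lemma mxdotL2_ae_zero u w : L2vec Om u -> L2vec Om w -> ae_zero Om u ->
  mxdotL2 Om u w = 0.
Proof.
move=> Lu Lw u0; rewrite /mxdotL2 /vint /Rintegral.
rewrite (ae_eq_integral (cst 0%E))//.
- by rewrite integral0.
- by case/integrableP: (mxdotL2_integrable Lu Lw).
apply: filterS u0 => x /[apply] ux0 /=.
by rewrite ux0 big_ord1 big1// => j _; rewrite mxE mul0r.
Qed.

End L2_forms.

(** * Linearity of the gradient *)

Section weak_gradients.
Context {R : realType} {d : nat} {Om : set 'rV[R]_d}.
Hypothesis oOm : open Om.
Hypothesis bOm : bounded_set Om.
Local Notation leb := (@lebesgue_rV R d).
Implicit Types (f g : 'rV[R]_d -> R) (G H : 'rV[R]_d -> 'rV[R]_d).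

Let mOm : measurable Om := measurable_open_rV oOm.

Lemma bounded_finite_measure : (leb Om < +oo)%E.
Proof.
have [M OmM] := bounded_sub_cbox bOm.
apply: le_lt_trans (lebesgue_rV_cbox_lty M).
by apply: le_measure; rewrite ?inE//; exact: measurable_cbox.
Qed.

(** A continuous function is bounded on a compact box containing the bounded set
[Om]; in particular test functions and their derivatives are in [L2]. *)
Lemma L2_continuous f : continuous f -> L2 Om f.
Proof.
move=> cf; have mf : measurable_fun Om f.
  by apply: measurable_funTS; exact: measurable_continuous_rV.
split => //; apply: measurable_bounded_integrable => //.
- exact: bounded_finite_measure.
- exact: measurable_funX.
have [M OmM] := bounded_sub_cbox bOm.
have /compact_bounded[B [Br fB]] : compact (f @` cbox (const_mx (- M)) (const_mx M)).
  by apply: continuous_compact; [exact: continuous_subspaceT | exact: compact_cbox].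
exists ((B + 1) ^+ 2); split; first exact: num_real.
move=> y yB x Ox /=; apply: le_trans (ltW yB).
rewrite normrX.
have fx : `|f x| <= B + 1.
  have Bl : B < B + 1 by rewrite ltrDl.
  by apply: (fB _ Bl); exists x => //; exact: OmM.
by rewrite lerXn2r ?nnegrE// (le_trans _ fx).
Qed.

Lemma L2_integrable f : L2 Om f -> leb.-integrable Om (EFin \o f).
Proof.
move=> Lf; have L1 : L2 Om (cst 1) by apply: L2_continuous; exact: cst_continuous.
by have := L2M_integrable mOm Lf L1; under eq_fun do rewrite mulr1.
Qed.

Lemma weak_grad_lin (a : R) f g G H : L2 Om f -> L2 Om g ->
  weak_grad Om f G -> weak_grad Om g H -> weak_grad Om (a *: f + g) (a *: G + H).
Proof.
move=> Lf Lg [LG fG] [LH gH]; split; first exact: L2vec_lin.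
move=> i psi tpsi; have [sm _] := tpsi.
have Lpsi : L2 Om psi by apply: L2_continuous; exact: (sm [::]).1.
have Ldpsi : L2 Om (partial i psi) by apply: L2_continuous; exact: (sm [:: i]).1.
have -> : (fun x => (a *: G + H) x 0 i) = a *: (fun x => G x 0 i) + (fun x => H x 0 i).
  by apply/funext => x; rewrite !fctE !mxE.
by rewrite !dotL2_lin// fG// gH// mulrN -opprD.
Qed.

Lemma weak_grad_ae_unique f G H : weak_grad Om f G -> weak_grad Om f H ->
  ae_zero Om (- 1 *: G + H).
Proof.
move=> [LG fG] [LH fH].
have comp i : ae_zero Om (- 1 *: (fun x => G x 0 i) + (fun x => H x 0 i)).
  have L : L2 Om (- 1 *: (fun x => G x 0 i) + (fun x => H x 0 i)) by exact: L2_lin.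
  apply: ae_zero_test_function => //; first exact: L2_integrable.
  move=> psi tpsi; have [sm _] := tpsi.
  have Lpsi : L2 Om psi by apply: L2_continuous; exact: (sm [::]).1.
  rewrite -/(dotL2 Om _ psi) dotL2_lin//.
  have := fG i psi tpsi; rewrite (fH i psi tpsi) => /oppr_inj ->.
  by rewrite mulN1r addNr.
have compA : {ae leb, forall x, forall i, Om x ->
    (- 1 *: (fun x => G x 0 i) + (fun x => H x 0 i)) x = 0}.
  by apply: (@filter_forall _ _ (fun i x => Om x -> _ = 0)
    (almost_everywhere leb)) => i; exact: comp.
apply: (filterS _ compA) => x cx Ox; apply/rowP => i.
by have := cx i Ox; rewrite !fctE !mxE.
Qed.

Lemma grad_weak_grad f : H1 Om f -> weak_grad Om f (grad Om f).
Proof. by move=> [_ [G fG]]; exact: xgetPex (ex_intro _ G fG). Qed.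

Lemma H1_lin (a : R) f g : H1 Om f -> H1 Om g -> H1 Om (a *: f + g).
Proof.
move=> Hf Hg; have [Lf _] := Hf; have [Lg _] := Hg.
split; first exact: L2_lin.
by eexists; apply: weak_grad_lin => //; exact: grad_weak_grad.
Qed.

(** The representative chosen by [grad] for [a *: f + g] need not be the
combination of those chosen for [f] and [g]; the two agree almost everywhere,
which is enough under an integral. *)
Lemma mxdotL2_grad_lin (a : R) f g G : H1 Om f -> H1 Om g -> L2vec Om G ->
  mxdotL2 Om (grad Om (a *: f + g)) G =
  a * mxdotL2 Om (grad Om f) G + mxdotL2 Om (grad Om g) G.
Proof.
move=> Hf Hg LG; have [Lf _] := Hf; have [Lg _] := Hg.
have wf := grad_weak_grad Hf; have wg := grad_weak_grad Hg.
have wl := weak_grad_lin a Lf Lg wf wg.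
have w := grad_weak_grad (H1_lin a Hf Hg).
rewrite -mxdotL2_lin//; [|exact: wf.1|exact: wg.1].
have z := mxdotL2_ae_zero mOm (L2vec_lin mOm (-1) w.1 wl.1) LG (weak_grad_ae_unique w wl).
move: z; rewrite mxdotL2_lin//; [|exact: w.1|exact: wl.1].
by rewrite mulN1r addrC => /eqP; rewrite subr_eq0 => /eqP.
Qed.

End weak_gradients.

(** * Coefficients of the scheme *)

Section coefficients.
Context {R : realType} (par : params R).

Lemma cutoffE (a : R) : cutoff a = Num.max (- 1) (Num.min a 1).
Proof.
rewrite /cutoff ler_norml; have [a1|a1] := leP a 1.
  rewrite andbT; have [m1a|am1] := leP (-1) a; first by [].
  by rewrite ltr0_sg// (lt_trans am1).
by rewrite andbF gtr0_sg ?(lt_trans _ a1)// max_r// (le_trans _ ler01) ?oppr_le0.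
Qed.

Lemma cutoff_itv (a : R) : -1 <= cutoff a <= 1.
Proof.
by rewrite cutoffE le_max lexx/= ge_max ge_min lexx orbT andbT; lra.
Qed.

(** The expression is the weighted mean
[(c1 (1 + x) + c2 (1 - x)) / (2 r)] of [c1 / r] and [c2 / r]. *)
Lemma mean_combination_itv (c1 c2 r x : R) : 0 < c1 -> 0 < c2 -> 0 < r ->
  -1 <= x <= 1 ->
  0 <= (c1 - c2) / (2 * r) * x + (c1 + c2) / (2 * r) <= (c1 + c2) / r.
Proof.
move=> c10 c20 r0 /andP[x1 x2]; have r0' : r != 0 by rewrite gt_eqF.
have -> : (c1 - c2) / (2 * r) * x + (c1 + c2) / (2 * r) =
    (c1 * (1 + x) + c2 * (1 - x)) / (2 * r) by field.
have -> : (c1 + c2) / r = (2 * (c1 + c2)) / (2 * r) by field.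
apply/andP; split; first by rewrite divr_ge0//; nra.
by rewrite ler_pM2r ?invr_gt0 ?mulr_gt0//; nra.
Qed.

Lemma rho_itv (a : R) : 0 <= rho par a <= (rho1 par + rho2 par) / rhor par.
Proof.
have [_ [? ? ?] _ _] := params_gt0 par.
by apply: mean_combination_itv => //; exact: cutoff_itv.
Qed.

Lemma eta_ge0 (a : R) : 0 <= eta par a.
Proof.
have [_ _ [? ? ?] _] := params_gt0 par.
by have /andP[] := mean_combination_itv (c1 := eta1 par) (c2 := eta2 par)
  (r := etar par) ltac:(done) ltac:(done) ltac:(done) (cutoff_itv a).
Qed.

Lemma sigma_bounded (a : R) :
  `|sigma par a| <= Num.sqrt ((rho1 par + rho2 par) / rhor par).
Proof.
have /andP[r0 r1] := rho_itv a.
by rewrite ger0_norm ?sqrtr_ge0// ler_sqrt// (le_trans r0).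
Qed.

Lemma measurable_sigma : measurable_fun [set: R] (sigma par).
Proof.
have ms : measurable_fun [set: R] (@Num.sqrt R).
  by apply: continuous_measurable_fun; exact: sqrt_continuous.
have mc : measurable_fun [set: R] (@cutoff R).
  rewrite (_ : @cutoff R = fun a => Num.max (-1) (Num.min a 1)); last first.
    by apply/funext => a; exact: cutoffE.
  by apply: measurable_maxr => //; exact: measurable_minr.
apply: (measurableT_comp ms); apply: measurable_funD => //.
by apply: measurable_funM.
Qed.

End coefficients.

Lemma finite_dim_subspace_lin (R : realType) (W : lmodType R) (V : set W)
    (a : R) (f g : W) :
  finite_dim_subspace V -> V f -> V g -> V (a *: f + g).
Proof.
move=> [m [b ->]] [cf _ <-] [cg _ <-]; exists (fun i => a * cf i + cg i) => //.
rewrite scaler_sumr -big_split /=.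
by apply: eq_bigr => i _; rewrite scalerDl scalerA.
Qed.

Section scheme_terms.
Context {R : realType} {d : nat} (par : params R) (Om : set 'rV[R]_d)
  (X : trajectory R d).

(** The weight [sigmat] sits on the difference quotient in the momentum equation;
moving it to the velocity turns the term into the product of a difference
quotient with its own newest value. *)
Lemma mxdotL2_sigmat (J : nat) (tau : R) n :
  mxdotL2 Om (fun x => sigmat par X n.+1 x *: ddt J tau (sigmau par X) n x)
    (vel X n.+1) =
  mxdotL2 Om (ddt J tau (sigmau par X) n) (sigmau par X n.+1).
Proof.
rewrite /mxdotL2; congr vint; apply/funext => x.
apply: eq_bigr => i _; apply: eq_bigr => j _.
by rewrite mxE [sigmau par X n.+1 x i j]mxE mulrCA mulrA.
Qed.

Lemma mxdotL2_etat n (A : 'rV[R]_d -> 'M[R]_d) :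
  mxdotL2 Om (fun x => etat par X n x *: A x) A =
  mxnormL2 Om (fun x => Num.sqrt (etat par X n x) *: A x) ^+ 2.
Proof.
rewrite mxnormL2_sqr /mxdotL2; congr vint; apply/funext => x.
apply: eq_bigr => i _; apply: eq_bigr => j _.
rewrite !mxE mulrACA -expr2 sqr_sqrtr ?mulrA//.
exact: eta_ge0.
Qed.

End scheme_terms.

(** * The energy law *)

(** All the couplings cancel here. The letters are the values of the integrals in
the equations tested with the new unknowns: [dm] is [(ddt phi, mu)]; [gg], [pp]
and [ss] pair the difference quotients of the gradient of [phi], of [phi] and
of [sigma u] with their newest values; [Gd], [pu], [pg] and [B] are coupling
terms; [D] and [M] are the physical dissipations. The equation of [R] scaled by
[4 tau R / (We Cn)] cancels [Gd], [pu] and [pg]; that of [Q] scaled by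
[2 tau Q] cancels [B]. *)
Lemma tested_equations_balance (R : realType) (Cn Pe Re We s T tau U e Rn Qn : R)
    (dR dQ Gd pu pg dm gg pp ss D B M : R) : Cn != 0 -> We != 0 -> Pe != 0 ->
  dm = Rn / U * pu - Pe^-1 * M ->
  dm = Cn ^+ 2 * gg + s * pp + Rn / U * Gd ->
  dR = (2 * U)^-1 * (Gd - pu + pg) ->
  ss + 2 / Re * D = - (e * Qn / 2) * B - Rn / U / (We * Cn) * pg ->
  dQ = - (Qn / T) + 2^-1 * e * B ->
  2 * tau * ss + Cn / We * (2 * tau * gg) + s * (We * Cn)^-1 * (2 * tau * pp)
  + 2 * (We * Cn)^-1 * (2 * tau * (dR * Rn)) + 2 * tau * (dQ * Qn) =
  - (4 * tau / Re * D) - 2 * tau / T * Qn ^+ 2 - 2 * tau / (Pe * We * Cn) * M.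
Proof.
move=> Cn0 We0 Pe0; rewrite [(2 * U)^-1]invfM.
move: (U^-1) (T^-1) (Re^-1) => iU iT iRe Ephi Emu ER Evel EQ.
have -> : Cn / We * (2 * tau * gg) =
    2 * tau * (We * Cn)^-1 * (Rn * iU * pu - Pe^-1 * M - s * pp - Rn * iU * Gd).
  rewrite -Ephi Emu; field; by rewrite Cn0 We0.
have -> : ss = - (e * Qn / 2) * B - Rn * iU / (We * Cn) * pg - 2 * iRe * D.
  by rewrite -Evel addrK.
rewrite ER EQ; field.
by rewrite Cn0 We0 Pe0.
Qed.

Lemma telescoped_sum (R : realType) (c2 c3 c4 : R)
    (e1 e2 e3 e4 e5 f1 f2 f3 f4 f5 l1 l2 l3 l4 l5 x y z : R) :
  e1 - f1 + l1 + c2 * (e2 - f2 + l2) + c3 * (e3 - f3 + l3)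
  + c4 * (e4 - f4 + l4) + (e5 - f5 + l5) = - x - y - z ->
  e1 + c2 * e2 + c3 * e3 + c4 * e4 + e5
  - (f1 + c2 * f2 + c3 * f3 + c4 * f4 + f5) =
  - (l1 + c2 * l2 + c3 * l3 + c4 * l4 + l5) - x - y - z.
Proof. by move=> balance; lra. Qed.

(** Comparing the norms of two different fields up to conversion would unfold the
integrals; before any algebra their squares are therefore made variables. *)
Ltac abstract_forms :=
  rewrite /mxnormL2 /normL2; repeat match goal with
  | |- context [mxdotL2 ?O ?A ?A] =>
      move: (mxdotL2_ge0 A : 0 <= mxdotL2 O A A); generalize (mxdotL2 O A A) => ? ?
  | |- context [dotL2 ?O ?f ?f] =>
      move: (dotL2_ge0 f : 0 <= dotL2 O f f); generalize (dotL2 O f f) => ? ?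
  end.

Section energy_law.
Context {R : realType} {d : nat} {Om : set 'rV[R]_d} {Vh : set ('rV[R]_d -> R)}
  {Xh : set ('rV[R]_d -> 'rV[R]_d)} {Mh : set ('rV[R]_d -> R)}
  {par : params R} {J : nat} {T tau : R} {N : nat}
  {force : ('rV[R]_d -> R) -> 'rV[R]_d -> 'rV[R]_d} {X : trajectory R d}.
Hypothesis oOm : open Om.
Hypothesis bOm : bounded_set Om.
Hypothesis fdVh : finite_dim_subspace Vh.
Hypothesis VhH1 : forall v, Vh v -> H1 Om v.
Hypothesis XhH10 : forall v, Xh v -> H10vec Om v.
Hypothesis J12 : J = 1%N \/ J = 2%N.
Hypothesis tau0 : 0 < tau.
Hypothesis hX : PG_solution par Om J T tau force X Vh Xh Mh N.

Let mOm : measurable Om := measurable_open_rV oOm.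

Let VhL2 v : Vh v -> L2 Om v.
Proof. by move=> /VhH1[]. Qed.

Let XhL2 v : Xh v -> L2vec Om v.
Proof. by move=> /XhH10 Hv i; have [[]] := Hv i. Qed.

Let Vh_lin (a : R) f g : Vh f -> Vh g -> Vh (a *: f + g).
Proof. exact: finite_dim_subspace_lin. Qed.

Let VhZ (c : R) f : Vh f -> Vh (c *: f).
Proof. exact: lin_closedZ. Qed.

Let VhB (c : R) f g : Vh f -> Vh g -> Vh (c *: f - g).
Proof. by move=> Vf Vg; apply: Vh_lin => //; exact: lin_closedN. Qed.

Let extrapVh n : (n <= N)%N -> Vh (extrap J (phi X) n).
Proof.
move=> nN; have [Vn _ _] := PG_levels hX nN.
have [Vn1 _ _] := PG_levels hX (leq_trans (leq_pred n) nN).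
by rewrite /extrap; case: ifP => // _; exact: VhB.
Qed.

Let ddtVh n : (n < N)%N -> Vh (ddt J tau (phi X) n).
Proof.
move=> nN; have [Vn1 _ _] := PG_levels hX nN.
have [Vn _ _] := PG_levels hX (ltnW nN).
have [Vn0 _ _] := PG_levels hX (leq_trans (leq_pred n) (ltnW nN)).
rewrite /ddt /hatted; apply: VhZ; case: ifP => _; apply: VhB => //.
by apply: VhB => //; exact: VhZ.
Qed.

Let phitVh n : (0 < n <= N)%N -> Vh (phit X n).
Proof.
(* The level 1 of the two-step scheme is part of the starting data. *)
case: n => // n /= nN; have [Jn|nJ] := leqP J n.+1.
  by rewrite (PG_phit hX)//; apply: extrapVh; exact: ltnW.
exact: (PG_phit_start hX).
Qed.

Let sigmauL2 n : (n <= N)%N -> L2vec Om (sigmau par X n).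
Proof.
move=> nN i; have [Vn _ Un] := PG_levels hX nN.
rewrite (_ : (fun x => _) = fun x => sigmat par X n x * vel X n x 0 i); last first.
  by apply/funext => x; rewrite mxE.
apply: (L2_mul_bounded mOm _ (fun x => sigma_bounded par _)); last exact: XhL2.
apply: (measurableT_comp (measurable_sigma par)).
case: n nN Vn Un => [|n] nN Vn Un; first by have [] := VhL2 Vn.
by have [] := VhL2 (@phitVh n.+1 nN).
Qed.

Let grad_form f g : R := mxdotL2 Om (grad Om f) (grad Om g).

Let tau_neq0 : tau != 0 := lt0r_neq0 tau0.

Let grad_form_lin (c : R) f g h : H1 Om f -> H1 Om g -> H1 Om h ->
  grad_form (c *: f + g) h = c * grad_form f h + grad_form g h.
Proof.
move=> Hf Hg Hh; apply: (mxdotL2_grad_lin oOm bOm) => //.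
by have [] := grad_weak_grad Hh.
Qed.

Let phiH1 n k : (n < N)%N -> (k <= n.+1)%N -> H1 Om (phi X k).
Proof. by move=> nN kn; have [/VhH1] := PG_levels hX (leq_trans kn nN). Qed.

Let grad_phi_telescope n : (n < N)%N -> (J <= n.+1)%N ->
  2 * tau * grad_form (ddt J tau (phi X) n) (phi X n.+1) =
  step_energy grad_form J (phi X) n.+1 - step_energy grad_form J (phi X) n
  + step_loss grad_form J (phi X) n.+1.
Proof.
move=> nN Jn; exact: (@ddt_polarization R _ (H1 Om) grad_form (H1_lin oOm bOm)
  (fun f g => mxdotL2C _ _) grad_form_lin J (phi X) tau n tau_neq0 J12 Jn
  (fun k => @phiH1 n k nN)).
Qed.

Let phi_telescope n : (n < N)%N -> (J <= n.+1)%N ->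
  2 * tau * dotL2 Om (ddt J tau (phi X) n) (phi X n.+1) =
  step_energy (dotL2 Om) J (phi X) n.+1 - step_energy (dotL2 Om) J (phi X) n
  + step_loss (dotL2 Om) J (phi X) n.+1.
Proof.
move=> nN Jn; exact: (@ddt_polarization R _ (L2 Om) (dotL2 Om) (L2_lin mOm)
  (@dotL2C R d Om) (dotL2_lin mOm) J (phi X) tau n tau_neq0 J12 Jn
  (fun k kn => (@phiH1 n k nN kn).1)).
Qed.

Let field_form (u w : 'rV[R]_d -> 'rV[R]_d) : R := mxdotL2 Om u w.

Let sigmau_telescope n : (n < N)%N -> (J <= n.+1)%N ->
  2 * tau * field_form (ddt J tau (sigmau par X) n) (sigmau par X n.+1) =
  step_energy field_form J (sigmau par X) n.+1
  - step_energy field_form J (sigmau par X) n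
  + step_loss field_form J (sigmau par X) n.+1.
Proof.
move=> nN Jn; exact: (@ddt_polarization R _ (L2vec Om) field_form (L2vec_lin mOm)
  (fun u w => mxdotL2C u w) (mxdotL2_lin mOm) J (sigmau par X) tau n tau_neq0 J12 Jn
  (fun k kn => sigmauL2 (leq_trans kn nN))).
Qed.

Let scalar_form (x y : R^o) : R := x * y.

Let scalar_form_lin (c : R) (x y z : R^o) :
  [set: R^o] x -> [set: R^o] y -> [set: R^o] z ->
  scalar_form (c *: x + y) z = c * scalar_form x z + scalar_form y z.
Proof. by move=> _ _ _; rewrite /scalar_form mulrDl -mulrA. Qed.

Let scalar_telescope (chi : nat -> R^o) n : (J <= n.+1)%N ->
  2 * tau * (scalar_form (ddt J tau chi n) (chi n.+1)) =
  step_energy scalar_form J chi n.+1 - step_energy scalar_form J chi n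
  + step_loss scalar_form J chi n.+1.
Proof.
move=> Jn; exact: (@ddt_polarization R R^o setT scalar_form (fun _ _ _ _ _ => I)
  (fun x y => mulrC x y) scalar_form_lin J chi tau n tau_neq0 J12 Jn (fun _ _ => I)).
Qed.

Let a := (Weber par * Cahn par)^-1.

Lemma energy_step_energy n : energy par Om J X n =
  step_energy field_form J (sigmau par X) n
  + Cahn par / Weber par * step_energy grad_form J (phi X) n
  + stab par * a * step_energy (dotL2 Om) J (phi X) n
  + 2 * a * step_energy scalar_form J (auxR X) n
  + step_energy scalar_form J (auxQ X) n.
Proof.
have [[C0 _ _ W0 _] _ _ _] := params_gt0 par.
have C0' := lt0r_neq0 C0; have W0' := lt0r_neq0 W0.
rewrite /energy /step_energy /field_form /grad_form /scalar_form -/a.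
case: J12 => -> /=; abstract_forms; rewrite !real_normK ?num_real// !sqr_sqrtr//.
by rewrite -!expr2 /a; field; rewrite C0' W0'.
Qed.

Lemma num_dissipation_step_loss n : num_dissipation par Om J X n =
  step_loss field_form J (sigmau par X) n
  + Cahn par / Weber par * step_loss grad_form J (phi X) n
  + stab par * a * step_loss (dotL2 Om) J (phi X) n
  + 2 * a * step_loss scalar_form J (auxR X) n
  + step_loss scalar_form J (auxQ X) n.
Proof.
have [[C0 _ _ W0 _] _ _ _] := params_gt0 par.
have C0' := lt0r_neq0 C0; have W0' := lt0r_neq0 W0.
rewrite /num_dissipation /step_loss /field_form /grad_form /scalar_form -/a.
case: J12 => -> /=; abstract_forms; rewrite !real_normK ?num_real// !sqr_sqrtr//.
  by rewrite -!expr2; ring.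
by rewrite -!expr2 /a; field; rewrite C0' W0'.
Qed.

Lemma energy_law n : (J <= n.+1)%N -> (n < N)%N ->
  ae_zero Om (forcet par force X n.+1) ->
  energy par Om J X n.+1 - energy par Om J X n =
  - num_dissipation par Om J X n.+1
  - 4 * tau / Reynolds par *
    mxnormL2 Om (fun x => Num.sqrt (etat par X n.+1 x)
                            *: symgrad Om (vel X n.+1) x) ^+ 2
  - 2 * tau / T * `|auxQ X n.+1| ^+ 2
  - 2 * tau / (Peclet par * Weber par * Cahn par) *
    mxnormL2 Om (grad Om (mu X n.+1)) ^+ 2.
Proof.
move=> Jn nN f0; have [Vphi Vmu Uvel] := PG_levels hX nN.
have JnN : (J <= n.+1 <= N)%N by rewrite Jn.
have [Ephi Emu ER Evel EQ] := PG_equations hX Jn nN.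
have force0 : mxdotL2 Om (forcet par force X n.+1) (vel X n.+1) = 0.
  by apply: mxdotL2_ae_zero => //; [exact: (PG_force hX) | exact: XhL2].
have {}Ephi := Ephi _ Vmu.
have {}Emu := Emu _ (ddtVh nN).
have {}Evel := Evel _ _ Uvel (PG_pres hX JnN).
(* The pressure terms cancel because the velocity and the pressure themselves
   are the test pair. *)
rewrite mxdotL2_sigmat mxdotL2_etat force0 (dotL2C (pres X n.+1)) mulr0 addr0 subrK
  in Evel.
rewrite (dotL2C (mu X n.+1)) (mxdotL2C _ (grad Om (ddt _ _ _ _)))
  (dotL2C (phi X n.+1)) in Emu.
rewrite -mxnormL2_sqr in Ephi.
have Rt := scalar_telescope (auxR X) Jn; have Qt := scalar_telescope (auxQ X) Jn.
have Et := sigmau_telescope nN Jn; have Pt := phi_telescope nN Jn.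
have Gt := grad_phi_telescope nN Jn.
have [[C0 P0 _ W0 _] _ _ _] := params_gt0 par.
have : 2 * tau * field_form (ddt J tau (sigmau par X) n) (sigmau par X n.+1)
    + Cahn par / Weber par * (2 * tau * grad_form (ddt J tau (phi X) n) (phi X n.+1))
    + stab par * a * (2 * tau * dotL2 Om (ddt J tau (phi X) n) (phi X n.+1))
    + 2 * a * (2 * tau * scalar_form (ddt J tau (auxR X) n) (auxR X n.+1))
    + 2 * tau * scalar_form (ddt J tau (auxQ X) n) (auxQ X n.+1) = _
  := tested_equations_balance tau (lt0r_neq0 C0) (lt0r_neq0 W0) (lt0r_neq0 P0)
       Ephi Emu ER Evel EQ.
rewrite Et Gt Pt Rt Qt => balance.
rewrite !energy_step_energy num_dissipation_step_loss real_normK ?num_real//.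
exact: telescoped_sum balance.
Qed.

End energy_law.

Unset Implicit Arguments.

Theorem theorem3 (R : realType) (d : nat) (hd : d = 2%N \/ d = 3%N)
    (Om : set 'rV[R]_d) (Hs : set R) (Th : R -> set 'M[R]_(d.+1, d))
    (Vh : R -> set ('rV[R]_d -> R)) (Xh : R -> set ('rV[R]_d -> 'rV[R]_d))
    (Nh : R -> set ('rV[R]_d -> R))
    (hfe : finite_element_setting Om Hs Th Vh Xh Nh)
    (h : R) (hh : Hs h)
    (par : params R) (J : nat) (hJ : J = 1%N \/ J = 2%N)
    (T tau : R) (N : nat) (hT : 0 < T) (htau : 0 < tau) (hN : (0 < N)%N)
    (hTtau : T = N%:R * tau)
    (force : ('rV[R]_d -> R) -> 'rV[R]_d -> 'rV[R]_d)
    (X : trajectory R d)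
    (hX : PG_solution par Om J T tau force X
            (Vh h) (Xh h) (zero_mean Om (Nh h)) N)
    (n : nat) (hJn : (J <= n.+1)%N) (hnN : (n < N)%N)
    (hf : ae_zero Om (forcet par force X n.+1)) :
  energy par Om J X n.+1 - energy par Om J X n =
  - num_dissipation par Om J X n.+1
  - 4 * tau / Reynolds par *
    mxnormL2 Om (fun x => Num.sqrt (etat par X n.+1 x)
                            *: symgrad Om (vel X n.+1) x) ^+ 2
  - 2 * tau / T * `|auxQ X n.+1| ^+ 2
  - 2 * tau / (Peclet par * Weber par * Cahn par) *
    mxnormL2 Om (grad Om (mu X n.+1)) ^+ 2.
Proof.
have [oOm _ bOm _ _] := fe_domain hfe.
have [fdV VH1] := fe_Vh hfe hh; have [_ XH10] := fe_Xh hfe hh.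
apply: (energy_law oOm bOm fdV _ _ hJ htau hX hJn hnN hf).
- by move=> v /VH1[].
- by move=> v /XH10[].
Qed.
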